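(* Let $k \geq 2$ and let $\Gamma = G = \mathbb{Z}/k\mathbb{Z}$. Suppose $A$ is a unital $C^*$-algebra with two commuting actions $\alpha$ and $\beta$ of $\mathbb{Z}/k\mathbb{Z}$, where $\alpha$ is free. Then there is no unital $*$-homomorphism $\phi: A \to J(A,\beta)$ which is both $(\alpha, \widetilde{\alpha})$-equivariant and $(\beta,\beta)$-equivariant.
   Context: Let $\omega = e^{2\pi i/k}$. The group $\Gamma=\mathbb{Z}/k\mathbb{Z}$ (acting through $\beta$) is identified with the Pontryagin dual of $G=\mathbb{Z}/k\mathbb{Z}$ (acting through $\alpha$). Actions are by $*$-automorphisms of $A$. Freeness: for an action $\alpha$ of a compact abelian group $G$ on a unital $C^*$-algebra $A$ and a character $\gamma \in \widehat{G}$, the $\gamma$-isotypic subspace is $A_\gamma = \{a \in A : \alpha_g(a) = \gamma(g)a \text{ for all } g \in G\}$. The action is free if $1 \in \overline{A_\gamma A_\gamma^*}$ for every $\gamma \in \widehat{G}$, where $A_\gamma A_\gamma^*$ is the linear span of the products $ab^*$ with $a,b\in A_\gamma$. Crossed product: $A \rtimes_\beta \Gamma$ is the crossed product $C^*$-algebra, generated by $A$ and by $\Gamma$ as a group of unitaries implementing $\beta$. Writing $\mu$ for the unitary corresponding to a generator of $\Gamma$, its elements are uniquely $\sum_{j=0}^{k-1} a_j\mu^j$ with $a_j \in A$. Both $A$ and $C^*(\Gamma)$ are regarded as unital subalgebras. Twisted join: $J(A,\beta) = \{f \in C([0,1], A\rtimes_\beta \Gamma) : f(0) \in C^*(\Gamma),\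 f(1) \in A\}$. Action $\widetilde{\alpha}$: since $\alpha$ and $\beta$ commute, $\alpha$ extends to $A\rtimes_\beta\Gamma$ by fixing every element of $\Gamma$. The dual action $\widehat{\beta}$ of $G$ on $A\rtimes_\beta\Gamma$ is given by $\widehat{\beta}_g(a)=a$ for $a\in A$ and $\widehat{\beta}_g(\gamma) = \gamma(g)\gamma$ for $\gamma\in\Gamma = \widehat{G}$. The action $\widetilde{\alpha}$ of $G$ on $J(A,\beta)$ is the pointwise application of $\alpha\widehat{\beta}$. Concretely, $\alpha\widehat\beta$ is generated by the automorphism $\sum_j a_j\mu^j \mapsto \sum_j \omega^j\alpha(a_j)\mu^j$, where $\alpha$ also denotes the automorphism generating the action $\alpha$. Action $\beta$ on $J(A,\beta)$: $\beta$ is extended to $A\rtimes_\beta\Gamma$ so that each element of $\Gamma$ is fixed, and the pointwise application of this extension on $J(A,\beta)$ is also denoted $\beta$. A map $\phi$ is $(\sigma,\tau)$-equivariant if $\phi\circ\sigma_g = \tau_g\circ\phi$ for all group elements $g$. *)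

(* Defs.v *)
From HB Require Import structures.
From mathcomp Require Import all_boot all_order all_algebra.
From mathcomp Require Import all_classical all_reals all_analysis.
From mathcomp Require Import complex.

Set Implicit Arguments.
Unset Strict Implicit.
Unset Printing Implicit Defensive.

Import Order.TTheory GRing.Theory Num.Theory.
Import numFieldNormedType.Exports.

Local Open Scope classical_set_scope.
Local Open Scope ring_scope.

HB.mixin Record isStarAlgebra (R : realType) A of GRing.Algebra R[i] A := {
  star : A -> A;
  starK : involutive star;
  starD : {morph star : x y / x + y};
  starZ : forall (c : R[i]) x, star (c *: x) = c^* *: star x;
  starM : forall x y, star (x * y) = star y * star x
}.

#[short(type="starAlgType")]
HB.structure Definition StarAlgebra (R : realType) :=
  {A of isStarAlgebra R A & GRing.Algebra R[i] A}.

(* Nonzero unital C*-algebras.  HB rejects a structure that joins a normed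
   module with an algebra, because numDomainType already inherits from both a
   normed Z-module and a ring.  The product and the involution are therefore
   fields here, and the algebra structure is derived from them below.  The norm
   is that of normedModType R[i], with (nonnegative) values in R[i]. *)
HB.mixin Record isCStarAlgebra (R : realType) A
    of CompleteNormedModule R[i] A := {
  cstar_one : A;
  cstar_mul : A -> A -> A;
  cstar_star : A -> A;
  cstar_mulA : associative cstar_mul;
  cstar_mul1x : left_id cstar_one cstar_mul;
  cstar_mulx1 : right_id cstar_one cstar_mul;
  cstar_mulDl : left_distributive cstar_mul +%R;
  cstar_mulDr : right_distributive cstar_mul +%R;
  cstar_one_neq0 : cstar_one != 0;
  cstar_scaleAl : forall (c : R[i]) (x y : A),
    c *: cstar_mul x y = cstar_mul (c *: x) y;
  cstar_scaleAr : forall (c : R[i]) (x y : A),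
    c *: cstar_mul x y = cstar_mul x (c *: y);
  cstar_starK : involutive cstar_star;
  cstar_starD : {morph cstar_star : x y / x + y};
  cstar_starZ : forall (c : R[i]) (x : A),
    cstar_star (c *: x) = c^* *: cstar_star x;
  cstar_starM : forall x y : A,
    cstar_star (cstar_mul x y) = cstar_mul (cstar_star y) (cstar_star x);
  cstar_normM : forall x y : A, `|cstar_mul x y| <= `|x| * `|y|;
  cstar_norm : forall x : A, `|cstar_mul (cstar_star x) x| = `|x| ^+ 2
}.

#[short(type="cstarAlgType")]
HB.structure Definition CStarAlgebra (R : realType) :=
  {A of isCStarAlgebra R A & CompleteNormedModule R[i] A}.

Section CStarAlgebraIsStarAlgebra.
Context (R : realType) (A : cstarAlgType R).

HB.instance Definition _ := GRing.Zmodule_isNzRing.Build (CStarAlgebra.sort A)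
  cstar_mulA cstar_mul1x cstar_mulx1 cstar_mulDl cstar_mulDr cstar_one_neq0.
HB.instance Definition _ :=
  GRing.Lmodule_isLalgebra.Build R[i] (CStarAlgebra.sort A) cstar_scaleAl.
HB.instance Definition _ :=
  GRing.Lalgebra_isAlgebra.Build R[i] (CStarAlgebra.sort A) cstar_scaleAr.
HB.instance Definition _ := isStarAlgebra.Build R (CStarAlgebra.sort A)
  cstar_starK cstar_starD cstar_starZ cstar_starM.

End CStarAlgebraIsStarAlgebra.

Definition unital_star_hom (R : realType) (A B : starAlgType R) (f : A -> B) :=
  [/\ linear f, monoid_morphism f & {morph f : x / star x}].

Section StarAlgebraTheory.
Context (R : realType) (A : starAlgType R).
Implicit Types x y : A.

Lemma star0 : star (0 : A) = 0.
Proof. by apply: (addrI (star 0)); rewrite -starD !addr0. Qed.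

Lemma starN x : star (- x) = - star x.
Proof. by apply: (addrI (star x)); rewrite -starD !subrr star0. Qed.

Lemma star1 : star (1 : A) = 1.
Proof. by rewrite -[LHS]mulr1 -[X in _ * X](starK 1) -starM mulr1 starK. Qed.

Lemma star_sum (I : Type) (r : seq I) (P : pred I) (F : I -> A) :
  star (\sum_(i <- r | P i) F i) = \sum_(i <- r | P i) star (F i).
Proof. exact: (big_morph _ (@starD R A) star0). Qed.

End StarAlgebraTheory.

Section CStarAlgebraTheory.
Context (R : realType) (A : cstarAlgType R).
Implicit Types x y : A.

Lemma normrM_le x y : `|x * y| <= `|x| * `|y|.
Proof. exact: cstar_normM. Qed.

Lemma norm_starM x : `|star x * x| = `|x| ^+ 2.
Proof. exact: cstar_norm. Qed.

Lemma norm_star x : `|star x| = `|x|.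
Proof.
have le y : `|y| <= `|star y|.
  have [->|y0] := eqVneq y 0; first by rewrite star0.
  by have := normrM_le (star y) y; rewrite norm_starM expr2 ler_pM2r ?normr_gt0.
by apply/eqP; rewrite eq_le le -{2}(starK x) le.
Qed.

Lemma star_continuous : continuous (@star R A).
Proof.
move=> x; apply/cvgrPdist_lt => e e0; near=> y.
rewrite -starN -starD norm_star; near: y.
exact: cvgr_dist_lt.
Unshelve. all: by end_near. Qed.

Lemma cvgM_cstar (T : Type) (F : set_system T) (FF : Filter F) (f g : T -> A)
    (a b : A) :
  f @ F --> a -> g @ F --> b -> (fun t => f t * g t) @ F --> a * b.
Proof.
move=> fa gb; apply/cvgrPdist_lt => e e0.
pose s : R[i] := `|b| + 1 + `|a| + 1; pose d := e / s.
have s0 : 0 < s by rewrite ltr_wpDl ?addr_ge0.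
have d0 : 0 < d by rewrite divr_gt0.
near=> t.
have -> : a * b - f t * g t = (a - f t) * g t + a * (b - g t).
  by rewrite mulrBl mulrBr [RHS]addrC addrA subrK.
have gt1 : `|g t| <= `|b| + 1.
  rewrite -[g t](subKr b) (le_trans (ler_normB _ _))// lerD2l ltW//.
  by near: t; exact: cvgr_dist_lt.
have fd : `|a - f t| <= d by rewrite ltW//; near: t; exact: cvgr_dist_lt.
have gd : `|b - g t| <= d by rewrite ltW//; near: t; exact: cvgr_dist_lt.
have le1 : `|(a - f t) * g t| <= d * (`|b| + 1).
  by rewrite (le_trans (normrM_le _ _))// ler_pM.
have le2 : `|a * (b - g t)| <= d * `|a|.
  by rewrite (le_trans (normrM_le _ _))// mulrC ler_pM.
rewrite (le_lt_trans (ler_normD _ _))// (le_lt_trans (lerD le1 le2))//.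
rewrite -mulrDr -[ltRHS](divfK (lt0r_neq0 s0)) -/d ltr_pM2l//.
by rewrite ltrDl.
Unshelve. all: by end_near. Qed.

End CStarAlgebraTheory.

(* Pointwise operations on functions; the pointed domain makes [1 != 0]. *)
Section FunctionAlgebra.
Context (R : realType) (T : pointedType) (A : starAlgType R).

Let fct_scaleAl (c : R[i]) (f g : T -> A) : c *: (f * g) = (c *: f) * g.
Proof. by apply/funext => t; exact: scalerAl. Qed.
HB.instance Definition _ :=
  GRing.Lmodule_isLalgebra.Build R[i] (T -> A) fct_scaleAl.

Let fct_scaleAr (c : R[i]) (f g : T -> A) : c *: (f * g) = f * (c *: g).
Proof. by apply/funext => t; exact: scalerAr. Qed.
HB.instance Definition _ :=
  GRing.Lalgebra_isAlgebra.Build R[i] (T -> A) fct_scaleAr.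

Let fct_star (f : T -> A) : T -> A := fun t => star (f t).
Let fct_starK : involutive fct_star.
Proof. by move=> f; apply/funext => t; exact: starK. Qed.
Let fct_starD : {morph fct_star : f g / f + g}.
Proof. by move=> f g; apply/funext => t; exact: starD. Qed.
Let fct_starZ (c : R[i]) f : fct_star (c *: f) = c^* *: fct_star f.
Proof. by apply/funext => t; exact: starZ. Qed.
Let fct_starM f g : fct_star (f * g) = fct_star g * fct_star f.
Proof. by apply/funext => t; exact: starM. Qed.
HB.instance Definition _ := isStarAlgebra.Build R (T -> A)
  fct_starK fct_starD fct_starZ fct_starM.

End FunctionAlgebra.

Section Actions.
Context (R : realType) (G : zmodType) (A : cstarAlgType R).

Record star_action := StarAction {
  act :> G -> A -> A;
  act_hom : forall g, unital_star_hom (act g);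
  act0 : forall a, act 0 a = a;
  actD : forall g h a, act (g + h) a = act g (act h a)
}.

Definition commuting (alpha beta : star_action) :=
  forall g h a, alpha g (beta h a) = beta h (alpha g a).

(* Characters of G as a discrete group; for finite G these are all of its
   Pontryagin dual. *)
Definition is_character (chi : G -> R[i]) :=
  [/\ chi 0 = 1, {morph chi : g h / g + h >-> g * h}
    & forall g, `|chi g| = 1].

Definition isotypic (alpha : star_action) (chi : G -> R[i]) : set A :=
  [set a | forall g, alpha g a = chi g *: a].

Definition lin_span (S : set A) : set A :=
  [set x | exists (n : nat) (c : 'I_n -> R[i]) (s : 'I_n -> A),
     (forall i, S (s i)) /\ x = \sum_(i < n) c i *: s i].

Definition free_action (alpha : star_action) :=
  forall chi, is_character chi ->
    closure (lin_span [set x | exists a b,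
      [/\ isotypic alpha chi a, isotypic alpha chi b & x = a * star b]]) 1.

End Actions.

(* e^{2 pi i / k} *)
Definition omega (R : realType) (k : nat) : R[i] :=
  Complex (cos (2 * pi / k%:R)) (sin (2 * pi / k%:R)).

Section CrossedProduct.
Context (R : realType) (k : nat) (A : cstarAlgType R).

(* The crossed product of A by Z/k along beta, specified up to isomorphism: the
   C*-norm is unique, and [cp_unit j] is the j-th power of the generating
   unitary mu. *)
Record crossed_product (beta : star_action 'Z_k A) := CrossedProduct {
  cp_alg :> cstarAlgType R;
  cp_emb : A -> cp_alg;
  cp_unit : 'Z_k -> cp_alg;
  cp_emb_hom : unital_star_hom cp_emb;
  cp_unit0 : cp_unit 0 = 1;
  cp_unitD : forall g h, cp_unit (g + h) = cp_unit g * cp_unit h;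
  cp_unitary : forall g, star (cp_unit g) * cp_unit g = 1 /\
                         cp_unit g * star (cp_unit g) = 1;
  cp_covariant : forall g a,
    cp_unit g * cp_emb a * star (cp_unit g) = cp_emb (beta g a);
  cp_expansion : forall b : cp_alg, exists! a : 'Z_k -> A,
    b = \sum_j cp_emb (a j) * cp_unit j
}.

Context (beta : star_action 'Z_k A) (B : crossed_product beta).

Definition cp_coef (b : B) : 'Z_k -> A := projT1 (cid (cp_expansion b)).

Lemma cp_coefK b : \sum_j cp_emb B (cp_coef b j) * cp_unit B j = b.
Proof. by rewrite /cp_coef; case: cid => a [/= <-]. Qed.

Lemma cp_coef_sum (a : 'Z_k -> A) :
  cp_coef (\sum_j cp_emb B (a j) * cp_unit B j) = a.
Proof. by rewrite /cp_coef; case: cid => a' [/= _ h]; exact: h. Qed.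

(* C*(Gamma); the span of a finite group of unitaries is closed. *)
Definition cp_group : set B :=
  [set b | exists c : 'Z_k -> R[i], b = \sum_j c j *: cp_unit B j].

Lemma cp_groupD x y : cp_group x -> cp_group y -> cp_group (x + y).
Proof.
move=> [c ->] [d ->]; exists (fun j => c j + d j).
by rewrite -big_split; apply: eq_bigr => j _; rewrite scalerDl.
Qed.

Lemma cp_groupZ (z : R[i]) x : cp_group x -> cp_group (z *: x).
Proof.
move=> [c ->]; exists (fun j => z * c j).
by rewrite scaler_sumr; apply: eq_bigr => j _; rewrite scalerA.
Qed.

Lemma cp_group_unit j : cp_group (cp_unit B j).
Proof.
exists (fun i => (i == j)%:R); rewrite (bigD1 j)//= eqxx scale1r big1 ?addr0//.
by move=> i /negPf ->; rewrite scale0r.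
Qed.

Lemma cp_group1 : cp_group 1.
Proof. by rewrite -(cp_unit0 B); exact: cp_group_unit. Qed.

Lemma cp_group_sum (F : 'Z_k -> B) :
  (forall j, cp_group (F j)) -> cp_group (\sum_j F j).
Proof.
move=> FP; apply: (big_ind cp_group) => [||j _]; [|exact: cp_groupD|exact: FP].
by rewrite -(scale0r 1); exact: cp_groupZ cp_group1.
Qed.

Lemma cp_groupM x y : cp_group x -> cp_group y -> cp_group (x * y).
Proof.
move=> [c ->] [d ->]; rewrite mulr_suml; apply: cp_group_sum => i.
rewrite mulr_sumr; apply: cp_group_sum => j.
rewrite -scalerAl -scalerAr -cp_unitD.
by do 2 apply: cp_groupZ; exact: cp_group_unit.
Qed.

Lemma star_cp_unit j : star (cp_unit B j) = cp_unit B (- j).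
Proof.
by rewrite -[LHS]mulr1 -(cp_unit0 B) -(subrr j) cp_unitD mulrA
           (cp_unitary B j).1 mul1r.
Qed.

Lemma cp_group_star x : cp_group x -> cp_group (star x).
Proof.
move=> [c ->]; rewrite star_sum; apply: cp_group_sum => j.
by rewrite starZ star_cp_unit; apply: cp_groupZ; exact: cp_group_unit.
Qed.

(* The extension to B, fixing each [cp_unit j], of an action on A that commutes
   with beta. *)
Definition cp_extend (theta : star_action 'Z_k A) (g : 'Z_k) (b : B) : B :=
  \sum_j cp_emb B (theta g (cp_coef b j)) * cp_unit B j.

(* The dual action: Z/k is paired with its dual by (j, g) |-> omega ^ (j g). *)
Definition cp_dual (g : 'Z_k) (b : B) : B :=
  \sum_(j : 'Z_k) omega R k ^+ (j * g)%N *: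
    (cp_emb B (cp_coef b j) * cp_unit B j).

End CrossedProduct.

Definition unit_interval (R : realType) : Type := `[0 : R, 1]%classic.
HB.instance Definition _ (R : realType) := Topological.on (unit_interval R).

Section UnitInterval.
Context (R : realType).
Let in01 (x : R) : 0 <= x <= 1 -> x \in `[0 : R, 1]%classic.
Proof. by move=> x01; rewrite inE /= in_itv. Qed.
Let zero01 : 0 <= (0 : R) <= 1. Proof. by rewrite lexx ler01. Qed.
Let one01 : 0 <= (1 : R) <= 1. Proof. by rewrite lexx ler01. Qed.
Definition ui0 : unit_interval R := exist _ 0 (in01 zero01).
Definition ui1 : unit_interval R := exist _ 1 (in01 one01).
HB.instance Definition _ := isPointed.Build (unit_interval R) ui0.
End UnitInterval.

Section TwistedJoin.
Context (R : realType) (k : nat) (A : cstarAlgType R).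
Context (beta : star_action 'Z_k A) (B : crossed_product beta).

Definition in_twisted_join (f : unit_interval R -> B) :=
  [/\ continuous f, cp_group (f (ui0 R)) & range (cp_emb B) (f (ui1 R))].

Definition twisted_join_pred : {pred unit_interval R -> B} :=
  fun f => `[< in_twisted_join f >].

Record twisted_join := TwistedJoin {
  tj_fun :> unit_interval R -> B;
  _ : tj_fun \in twisted_join_pred
}.

HB.instance Definition _ := [isSub for tj_fun].
HB.instance Definition _ := [Choice of twisted_join by <:].

Lemma twisted_join_subalg : subalg_closed twisted_join_pred.
Proof.
have [linE [emb1 embM] _] := cp_emb_hom B.
split.
- apply/asboolP; split; first exact: cst_continuous.
  + exact: cp_group1.
  + by exists 1.
- move=> c f g /asboolP[fC f0 [a _ fa]] /asboolP[gC g0 [b _ gb]].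
  apply/asboolP; split.
  + move=> t; have FF : Filter (nbhs t) by exact: nbhs_filter.
    exact: (cvgD (cvgZl_tmp (k := c) (fC t)) (gC t)).
  + by apply: cp_groupD => //; exact: cp_groupZ.
  + by exists (c *: a + b) => //; rewrite linE fa gb.
- move=> f g /asboolP[fC f0 [a _ fa]] /asboolP[gC g0 [b _ gb]].
  apply/asboolP; split.
  + move=> t; have FF : Filter (nbhs t) by exact: nbhs_filter.
    exact: (cvgM_cstar FF (fC t) (gC t)).
  + exact: cp_groupM.
  + by exists (a * b) => //; rewrite embM fa gb.
Qed.

Lemma twisted_join_star f :
  f \in twisted_join_pred -> star f \in twisted_join_pred.
Proof.
have [_ _ embS] := cp_emb_hom B.
move=> /asboolP[fC f0 [a _ fa]]; apply/asboolP; split.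
- move=> t; have ft : f x @[x --> t] --> f t by exact: fC.
  change (star (f x) @[x --> t] --> star (f t)).
  exact: (cvg_comp f (@star R B) ft (@star_continuous R B (f t))).
- exact: cp_group_star.
- by exists (star a) => //; rewrite embS fa.
Qed.

HB.instance Definition _ :=
  GRing.isSubalgClosed.Build R[i] _ twisted_join_pred twisted_join_subalg.
HB.instance Definition _ := [SubChoice_isSubAlgebra of twisted_join by <:].

Let tj_star (f : twisted_join) : twisted_join :=
  TwistedJoin (twisted_join_star (valP f)).
Let tj_starK : involutive tj_star.
Proof. by move=> f; apply/val_inj/funext => t; exact: (starK (f t)). Qed.
Let tj_starD : {morph tj_star : f g / f + g}.
Proof. by move=> f g; apply/val_inj/funext => t; exact: (starD (f t)). Qed.
Let tj_starZ (c : R[i]) f : tj_star (c *: f) = c^* *: tj_star f.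
Proof. by apply/val_inj/funext => t; exact: (starZ c (f t)). Qed.
Let tj_starM f g : tj_star (f * g) = tj_star g * tj_star f.
Proof. by apply/val_inj/funext => t; exact: (starM (f t) (g t)). Qed.
HB.instance Definition _ := isStarAlgebra.Build R twisted_join
  tj_starK tj_starD tj_starZ tj_starM.

(* The pointwise actions are given on all functions from [0,1] to B; both
   preserve the twisted join. *)
Definition join_act (alpha : star_action 'Z_k A) (g : 'Z_k)
    (f : unit_interval R -> B) : unit_interval R -> B :=
  fun t => cp_extend alpha g (cp_dual g (f t)).

Definition join_beta (g : 'Z_k) (f : unit_interval R -> B) :
    unit_interval R -> B :=
  fun t => cp_extend beta g (f t).

End TwistedJoin.

(* Main.v *)
Require Import Defs.
From HB Require Import structures.
From mathcomp Require Import all_boot all_order all_algebra.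
From mathcomp Require Import all_classical all_reals all_analysis.
From mathcomp Require Import complex.
From mathcomp Require Import lra.

(** Consider the space of characters of [A] that are invariant under [beta].
    Such a character [x] extends to the crossed product by sending the unitary
    generator to [1], and precomposing with the value of [phi] at time [t]
    gives an invariant character [flow t x] of [A].  At time [0] the values of
    [phi] lie in the group algebra, so [flow 0] is constant ([flow0]); at time
    [1] they lie in [A], where the dual action is trivial, so [flow 1] commutes
    with the action [char_act] of Z/k coming from [alpha]
    ([flow1_equivariant]).  Hence some equivariant self-map of this space is
    contractible to a point.  On the other hand freeness of [alpha] yields
    finitely many elements [a i] with [alpha g (a i) = omega ^+ g *: a i] that no
    character kills simultaneously ([isotypic_lower_bound]), that is, an
    equivariant map from the space of characters to a sphere of finite
    dimension.  These two facts contradict each other, by a statement of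
    Borsuk-Ulam type, which is proved here combinatorially.

    Let [g] be the generator of the action, [D_n = g - 1] for [n] even and
    [D_n = 1 + g + ... + g ^ (k - 1)] for [n] odd.  A tower is a sequence of
    cubical chains [h_0, h_1, ...] in the space of characters with [h_0] of
    augmentation [1] and [bd h_(n + 1) = D_n h_n]: a chain map out of the
    periodic resolution of the integers over the group ring of Z/k.
    Taking prisms along the flow extends a tower by one step at the cost of replacing
    it by its image under [flow 1] ([tower_cone]), because [D_n D_(n + 1) = 0].
    The cubes are families of points indexed by the vertices of a cube;
    continuity of [phi] enters only through the requirement that the vertices
    of a cube be near each other, which is achieved by cutting the time
    interval finely ([char_nbhd_cone]).  So there are towers of every height
    made of arbitrarily small cubes ([tower_exists]).

    Sorting the characters by the values at the [a i] of a representative of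
    their orbit, up to a small error, gives finitely many colors; together with
    the position in the orbit this labels the points by vertices of the join of
    [C] copies of Z/k, equivariantly, and in such a way that the vertices of a
    small cube span a simplex of the join.  A tower is therefore carried to a
    tower in the chain complex of the join ([bd_simplex]), which vanishes above
    dimension [C - 1] and consists of free modules over the group ring in
    nonnegative dimensions.  The exactness of the resolution on free modules
    ([alt_mod_exact]) permits to descend from dimension [C], where the tower
    vanishes, to dimension [0], where it shows that the augmentation [1] of
    [h_0] is a multiple of [k] ([tower_descent]). *)

Set Implicit Arguments.
Unset Strict Implicit.
Unset Printing Implicit Defensive.

Import Order.TTheory GRing.Theory Num.Theory.
Import numFieldNormedType.Exports.

Local Open Scope classical_set_scope.
Local Open Scope ring_scope.

(** * Combinatorial cubes and their coboundary *)

(** A [q]-cube in [X] assigns a point to each vertex of the unit [q]-cube.  The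
    recursion pairs points rather than cubes, so that a function on points with
    values in pairs turns a [q]-cube into a [q.+1]-cube: prisms are images
    under [cmap]. *)
Fixpoint cube (q : nat) (X : Type) : Type :=
  if q is q'.+1 then cube q' (X * X) else X.

Definition pmap2 (X Y : Type) (f : X -> Y) (p : X * X) : Y * Y :=
  (f p.1, f p.2).

Fixpoint cmap (q : nat) : forall X Y : Type, (X -> Y) -> cube q X -> cube q Y :=
  match q with
  | 0 => fun X Y f => f
  | q'.+1 => fun X Y f => @cmap q' (X * X)%type (Y * Y)%type (pmap2 f)
  end.

Fixpoint vertex (q : nat) : forall X : Type, cube q X -> X -> Prop :=
  match q with
  | 0 => fun X s x => s = x
  | q'.+1 => fun X s x =>
      exists2 p : X * X, @vertex q' (X * X)%type s p & x = p.1 \/ x = p.2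
  end.

Fixpoint base (q : nat) : forall X : Type, cube q X -> X :=
  match q with
  | 0 => fun X s => s
  | q'.+1 => fun X s => (@base q' (X * X)%type s).1
  end.

(** The two faces in the innermost direction; [thicken] makes a cube that is
    degenerate in that direction. *)
Definition front (q : nat) (X : Type) : cube q.+1 X -> cube q X :=
  @cmap q (X * X)%type X fst.
Definition back (q : nat) (X : Type) : cube q.+1 X -> cube q X :=
  @cmap q (X * X)%type X snd.
Definition thicken (q : nat) (X : Type) : cube q X -> cube q.+1 X :=
  @cmap q X (X * X)%type (fun x => (x, x)).

Lemma eq_cmap q X Y (f g : X -> Y) : f =1 g -> @cmap q X Y f =1 cmap g.
Proof.
elim: q X Y f g => [//|q IH] X Y f g fg s /=.
by apply: IH => p; rewrite /pmap2 !fg.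
Qed.

Lemma cmap_id q X (s : cube q X) : cmap id s = s.
Proof.
elim: q X s => [//|q IH] X s /=.
by rewrite -[RHS](IH (X * X)%type); apply: eq_cmap => -[].
Qed.

Lemma cmap_comp q X Y Z (f : X -> Y) (g : Y -> Z) (s : cube q X) :
  cmap g (cmap f s) = cmap (fun x => g (f x)) s.
Proof. by elim: q X Y Z f g s => [//|q IH] X Y Z f g s /=; rewrite IH. Qed.

Lemma base_cmap q X Y (f : X -> Y) (s : cube q X) : base (cmap f s) = f (base s).
Proof. by elim: q X Y f s => [//|q IH] X Y f s /=; rewrite IH. Qed.

Lemma vertex_base q X (s : cube q X) : vertex s (base s).
Proof.
elim: q X s => [//|q IH] X s /=; exists (@base q (X * X)%type s); last by left.
exact: IH.
Qed.

Lemma vertex_cmap q X Y (f : X -> Y) (s : cube q X) y :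
  vertex (cmap f s) y -> exists2 x, vertex s x & y = f x.
Proof.
elim: q X Y f s y => [|q IH] X Y f s y /=; first by exists s.
case=> p /(IH (X * X)%type (Y * Y)%type)[r sr ->] [->|->];
  [exists r.1|exists r.2] => //;
  exists r => //; by [left|right].
Qed.

Lemma front_cmap q X Y (f : X -> Y) (s : cube q.+1 X) :
  front (cmap f s) = cmap f (front s).
Proof.
rewrite /front (@cmap_comp q (X * X)%type X Y).
exact: (@cmap_comp q (X * X)%type (Y * Y)%type Y (pmap2 f)).
Qed.

Lemma back_cmap q X Y (f : X -> Y) (s : cube q.+1 X) :
  back (cmap f s) = cmap f (back s).
Proof.
rewrite /back (@cmap_comp q (X * X)%type X Y).
exact: (@cmap_comp q (X * X)%type (Y * Y)%type Y (pmap2 f)).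
Qed.

Lemma front_thicken q X (s : cube q X) : front (thicken s) = s.
Proof. by rewrite /front /thicken cmap_comp /= (@cmap_id q X). Qed.

Lemma back_thicken q X (s : cube q X) : back (thicken s) = s.
Proof. by rewrite /back /thicken cmap_comp /= (@cmap_id q X). Qed.

Lemma vertex_front q X (s : cube q.+1 X) x : vertex (front s) x -> vertex s x.
Proof.
move=> fx; have [p sp ->] := @vertex_cmap q (X * X)%type X fst s x fx.
by exists p => //; left.
Qed.

Lemma vertex_back q X (s : cube q.+1 X) x : vertex (back s) x -> vertex s x.
Proof.
move=> bx; have [p sp ->] := @vertex_cmap q (X * X)%type X snd s x bx.
by exists p => //; right.
Qed.

Section Coboundary.
Variable M : zmodType.

(** The coboundary, dual to the alternating sum of faces.  The faces in the
    remaining directions of a cube in [X] are the faces of the same cube seen as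
    a cube of pairs. *)
Fixpoint cobd (q : nat) : forall X : Type, (cube q X -> M) -> cube q.+1 X -> M :=
  match q with
  | 0 => fun X F s => F s.2 - F s.1
  | q'.+1 => fun X F s =>
      F (back s) - F (front s) - @cobd q' (X * X)%type F s
  end.

(** Vanishing on the cubes that are degenerate in some direction.  Contracting
    to a point sweeps out constant cubes at one end of the homotopy, which
    these functions ignore. *)
Fixpoint normalized (q : nat) : forall X : Type, (cube q X -> M) -> Prop :=
  match q with
  | 0 => fun X F => True
  | q'.+1 => fun X F =>
      (forall s : cube q' X, F (@thicken q' X s) = 0) /\
      @normalized q' (X * X)%type F
  end.

Lemma cobdS q X (F : cube q.+1 X -> M) s :
  cobd F s = F (back s) - F (front s) - @cobd q (X * X)%type F s.
Proof. by []. Qed.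

(** The vertices of a face are vertices of the cube.  For pairs the
    property to carry through the induction is that both components satisfy it. *)
Lemma eq_cobd_in q X (P : X -> Prop) (F F' : cube q X -> M) (s : cube q.+1 X) :
    (forall t, (forall x, vertex t x -> P x) -> F t = F' t) ->
  (forall x, vertex s x -> P x) -> cobd F s = cobd F' s.
Proof.
elim: q X P F F' s => [|q IH] X P F F' s FF' Ps.
  by rewrite /= !FF' // => x /= <-; apply: Ps; exists s => //; [left|right].
rewrite !cobdS; congr (_ - _ - _).
- by apply: FF' => x bx; apply: Ps; exact: vertex_back.
- by apply: FF' => x fx; apply: Ps; exact: vertex_front.
- apply: (IH (X * X)%type (fun p => P p.1 /\ P p.2)) => [t Pt|p sp].
    by apply: FF' => x [p /Pt[p1 p2]] [->|->].
  by split; apply: Ps; exists p => //; [left|right].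
Qed.

Lemma eq_cobd q X (F F' : cube q X -> M) (s : cube q.+1 X) :
  (forall t, F t = F' t) -> cobd F s = cobd F' s.
Proof. by move=> FF'; apply: (@eq_cobd_in q X (fun=> True)). Qed.

Lemma cobd_cmap q X Y (f : X -> Y) (F : cube q Y -> M) (s : cube q.+1 X) :
  cobd F (cmap f s) = cobd (fun t => F (cmap f t)) s.
Proof.
elim: q X Y f F s => [//|q IH] X Y f F s.
rewrite !cobdS back_cmap front_cmap; congr (_ - _).
exact: IH.
Qed.

End Coboundary.

Lemma cobd_closed (M : zmodType) (P : M -> Prop) q X (Q : X -> Prop)
    (F : cube q X -> M) (s : cube q.+1 X) :
    (forall u v, P u -> P v -> P (u - v)) ->
    (forall t, (forall x, vertex t x -> Q x) -> P (F t)) ->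
  (forall x, vertex s x -> Q x) -> P (cobd F s).
Proof.
move=> PB; elim: q X Q F s => [|q IH] X Q F s PF Qs.
  by apply: PB; apply: PF => x /= <-; apply: Qs; exists s => //; [right|left].
rewrite cobdS; apply: (PB); first apply: PB.
- by apply: PF => x bx; apply: Qs; exact: vertex_back.
- by apply: PF => x fx; apply: Qs; exact: vertex_front.
apply: (IH (X * X)%type (fun p => Q p.1 /\ Q p.2)) => [t Qt|p sp].
  by apply: PF => x [p /Qt[p1 p2]] [->|->].
by split; apply: Qs; exists p => //; [left|right].
Qed.

Lemma cobd_morph (M M' : zmodType) (h : {additive M -> M'}) q X
    (F : cube q X -> M) (s : cube q.+1 X) :
  h (cobd F s) = cobd (fun t => h (F t)) s.
Proof.
elim: q X F s => [|q IH] X F s; first by rewrite /= raddfB.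
by rewrite !cobdS !raddfB IH.
Qed.

Section CoboundaryTheory.
Variable M : zmodType.

Lemma cobdD q X (F F' : cube q X -> M) s :
  cobd (fun t => F t + F' t) s = cobd F s + cobd F' s.
Proof.
elim: q X F F' s => [|q IH] X F F' s; first by rewrite /= opprD addrACA.
by rewrite !cobdS IH !opprD [RHS]addrACA [X in _ = X + _]addrACA.
Qed.

Lemma cobdN q X (F : cube q X -> M) s :
  cobd (fun t => - F t) s = - cobd F s.
Proof. by rewrite (cobd_morph (-%R)). Qed.

Lemma cobdB q X (F F' : cube q X -> M) s :
  cobd (fun t => F t - F' t) s = cobd F s - cobd F' s.
Proof. by rewrite cobdD cobdN. Qed.

Lemma cobd0 q X (s : cube q.+1 X) : cobd (fun=> 0 : M) s = 0.
Proof.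
elim: q X s => [|q IH] X s; first by rewrite /= subrr.
by rewrite cobdS IH !subr0.
Qed.

Lemma cobd_sum (I : Type) (r : seq I) q X (F : I -> cube q X -> M) s :
  cobd (fun t => \sum_(i <- r) F i t) s = \sum_(i <- r) cobd (F i) s.
Proof.
elim: r => [|i r IH].
  by rewrite big_nil -[RHS](cobd0 s); apply: eq_cobd => t; rewrite big_nil.
by rewrite big_cons -IH -cobdD; apply: eq_cobd => t; rewrite big_cons.
Qed.

(** By naturality, the faces of the innermost direction commute with those of
    the other directions, and the latter cancel by induction. *)
Lemma cobd_cobd q X (F : cube q X -> M) (s : cube q.+2 X) :
  cobd (cobd F) s = 0.
Proof.
elim: q X F s => [|q IH] X F s.
  rewrite cobdS /back /front /=.
  case: s => -[a b] [c d] /=; apply/eqP.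
  by rewrite subr_eq0 [- (F c - _)]opprB [- (F b - _)]opprB addrACA [eqbRHS]addrACA
    [- F b - _]addrC.
rewrite cobdS (_ : @cobd _ q.+1 (X * X)%type (cobd F) s =
  cobd F (back s) - cobd F (front s)); first by rewrite subrr.
rewrite /back /front !cobd_cmap.
rewrite -cobdB -[RHS]subr0 -(IH (X * X)%type F s) -cobdB.
by apply: eq_cobd => t; rewrite cobdS.
Qed.

Lemma normalized_sub q X (F F' : cube q X -> M) :
  (forall s, F s = 0 -> F' s = 0) -> normalized F -> normalized F'.
Proof.
elim: q X F F' => [//|q IH] X F F' FF' [F0 nF]; split; last exact: IH nF.
by move=> s; apply: FF'; exact: F0.
Qed.

Lemma normalizedD q X (F F' : cube q X -> M) :
  normalized F -> normalized F' -> normalized (fun s => F s + F' s).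
Proof.
elim: q X F F' => [//|q IH] X F F' [F0 nF] [F'0 nF']; split; last exact: IH.
by move=> s; rewrite F0 F'0 addr0.
Qed.

Lemma normalized_sum (I : Type) (r : seq I) q X (F : I -> cube q X -> M) :
  (forall i, normalized (F i)) -> normalized (fun s => \sum_(i <- r) F i s).
Proof.
elim: q X F => [//|q IH] X F nF; split; last by apply: IH => i; case: (nF i).
by move=> s; rewrite big1 // => i _; case: (nF i) => ->.
Qed.

Lemma normalized_cmap q X Y (f : X -> Y) (F : cube q Y -> M) :
  normalized F -> normalized (fun s => F (cmap f s)).
Proof.
elim: q X Y f F => [//|q IH] X Y f F [F0 nF]; split; last exact: IH.
move=> s; rewrite -[RHS](F0 (cmap f s)); congr F.
by rewrite /thicken [LHS]/= !cmap_comp.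
Qed.

Lemma normalized_cst q X Y y (F : cube q.+1 Y -> M) (s : cube q.+1 X) :
  normalized F -> F (cmap (fun=> y) s) = 0.
Proof.
case=> F0 _; rewrite -(F0 (@cmap q (X * X)%type Y (fun=> y) s)); congr F.
by rewrite /thicken cmap_comp /=.
Qed.

(** On a degenerate cube the two faces in the degenerate direction are equal and
    come with opposite signs, and all other faces are degenerate. *)
Lemma normalized_cobd q X (F : cube q X -> M) :
  normalized F -> normalized (cobd F).
Proof.
elim: q X F => [|q IH] X F nF; first by split=> // s; rewrite /= subrr.
have [F0 nF'] := nF.
split.
  move=> s; rewrite cobdS back_thicken front_thicken subrr sub0r.
  have -> : @cobd M q (X * X)%type F (thicken s) = cobd (fun t => F (thicken t)) s.
    exact: (@cobd_cmap _ q X (X * X)%type (fun x => (x, x)) F s).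
  by rewrite (eq_cobd (F' := fun=> 0)) ?cobd0 ?oppr0.
pose XX := (X * X)%type.
have nN F' : @normalized M q.+1 XX F' -> @normalized M q.+1 XX (fun s => - F' s).
  by apply: normalized_sub => s ->; rewrite oppr0.
have nB : @normalized M q.+1 XX (fun s => F (@back q.+1 X s)).
  exact: (@normalized_cmap q.+1 XX X snd F nF).
have nA : @normalized M q.+1 XX (fun s => F (@front q.+1 X s)).
  exact: (@normalized_cmap q.+1 XX X fst F nF).
exact: (normalizedD (normalizedD nB (nN _ nA)) (nN _ (IH XX F nF'))).
Qed.

End CoboundaryTheory.

(** * Formal chains of cubes *)

Definition chain (q : nat) (X : Type) : Type := seq (int * cube q X).

(** Chains are only ever used as functionals on functions of cubes; two chains
    are the same when these functionals agree on normalized functions. *)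
Definition ceval (M : zmodType) q X (c : chain q X) (F : cube q X -> M) : M :=
  \sum_(p <- c) F p.2 *~ p.1.

Fixpoint supported q X (P : cube q X -> Prop) (c : chain q X) : Prop :=
  if c is p :: c' then P p.2 /\ supported P c' else True.

Definition chain_map q X Y (f : X -> Y) (c : chain q X) : chain q Y :=
  [seq (p.1, cmap f p.2) | p <- c].

Definition chain_opp q X (c : chain q X) : chain q X :=
  [seq (- p.1, p.2) | p <- c].

(** The chain swept by moving the points of a chain through the maps
    [H 0, ..., H m]. *)
Definition chain_prism q X (H : nat -> X -> X) (m : nat) (c : chain q X) :
    chain q.+1 X :=
  flatten [seq [seq (p.1, @cmap q X (X * X)%type (fun x => (H j x, H j.+1 x)) p.2)
    | p <- c] | j <- index_iota 0 m].

(** [E] is meant as a relation of nearness on [X]. *)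
Definition small q X (E : X -> X -> Prop) (s : cube q X) :=
  forall x y, vertex s x -> vertex s y -> E x y.

Section ChainTheory.
Context {M : zmodType} {q : nat} {X : Type}.
Implicit Types (c : chain q X) (F : cube q X -> M).

Lemma eq_ceval_in (P : cube q X -> Prop) c F F' :
  supported P c -> (forall s, P s -> F s = F' s) -> ceval c F = ceval c F'.
Proof.
rewrite /ceval => + FF'; elim: c => [|p c IH] /=; first by rewrite !big_nil.
by move=> [Pp /IH e]; rewrite !big_cons FF' // e.
Qed.

Lemma eq_ceval c F F' : F =1 F' -> ceval c F = ceval c F'.
Proof. by move=> FF'; apply: eq_bigr => p _; rewrite FF'. Qed.

Lemma ceval0 c : ceval c (fun=> 0 : M) = 0.
Proof. by apply: big1 => p _; rewrite mul0rz. Qed.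

Lemma cevalB c F F' : ceval c (fun s => F s - F' s) = ceval c F - ceval c F'.
Proof. by rewrite -sumrB; apply: eq_bigr => p _; rewrite mulrzBl. Qed.

Lemma ceval_sum (I : Type) (r : seq I) c (F : I -> cube q X -> M) :
  ceval c (fun s => \sum_(i <- r) F i s) = \sum_(i <- r) ceval c (F i).
Proof. by rewrite exchange_big; apply: eq_bigr => p _; rewrite mulrz_suml. Qed.

Lemma ceval_cat c c' F : ceval (c ++ c') F = ceval c F + ceval c' F.
Proof. by rewrite /ceval big_cat. Qed.

Lemma ceval_opp c F : ceval (chain_opp c) F = - ceval c F.
Proof. by rewrite /ceval big_map -sumrN; apply: eq_bigr => p _; rewrite mulrNz. Qed.

Lemma ceval_flatten (cs : seq (chain q X)) F :
  ceval (flatten cs) F = \sum_(c <- cs) ceval c F.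
Proof. by rewrite /ceval big_flatten. Qed.

Lemma supported_cat (P : cube q X -> Prop) c c' :
  supported P c -> supported P c' -> supported P (c ++ c').
Proof. by elim: c => //= p c IH [Pp /IH h] /h. Qed.

Lemma supported_flatten (I : eqType) (P : cube q X -> Prop) (r : seq I)
    (c : I -> chain q X) :
  (forall i, i \in r -> supported P (c i)) ->
  supported P (flatten [seq c i | i <- r]).
Proof.
elim: r => //= i r IH Pc; apply: supported_cat; first by apply: Pc; exact: mem_head.
by apply: IH => j jr; apply: Pc; rewrite in_cons jr orbT.
Qed.

Lemma supported_opp (P : cube q X -> Prop) c :
  supported P c -> supported P (chain_opp c).
Proof. by elim: c => //= p c IH [Pp /IH]. Qed.

End ChainTheory.

Lemma ceval_morph (M M' : zmodType) (h : {additive M -> M'}) q X (c : chain q X)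
    (F : cube q X -> M) :
  h (ceval c F) = ceval c (fun s => h (F s)).
Proof. by rewrite raddf_sum; apply: eq_bigr => p _; rewrite raddfMz. Qed.

Lemma ceval_map (M : zmodType) q X Y (f : X -> Y) (c : chain q X)
    (F : cube q Y -> M) :
  ceval (chain_map f c) F = ceval c (fun s => F (cmap f s)).
Proof. by rewrite /ceval big_map. Qed.

Lemma ceval_prism (M : zmodType) q X (H : nat -> X -> X) m (c : chain q X)
    (F : cube q.+1 X -> M) :
  ceval (chain_prism H m c) F =
  ceval c (fun s => \sum_(0 <= j < m)
    F (@cmap q X (X * X)%type (fun x => (H j x, H j.+1 x)) s)).
Proof.
rewrite ceval_flatten big_map ceval_sum; apply: eq_bigr => j _.
by rewrite /ceval big_map.
Qed.

Lemma supported_map q q' X Y (P : cube q X -> Prop) (P' : cube q' Y -> Prop)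
    (f : cube q X -> cube q' Y) (c : chain q X) :
  (forall s, P s -> P' (f s)) -> supported P c ->
  supported P' [seq (p.1, f p.2) | p <- c].
Proof. by move=> PP'; elim: c => //= p c IH [/PP' ? /IH]. Qed.

Lemma small_cmap q X Y (E : X -> X -> Prop) (E' : Y -> Y -> Prop) (f : X -> Y)
    (s : cube q X) :
  (forall x y, E x y -> E' (f x) (f y)) -> small E s -> small E' (cmap f s).
Proof.
move=> EE' Es x y fx fy.
have [[x' sx ->] [y' sy ->]] := (vertex_cmap fx, vertex_cmap fy).
by apply: EE'; exact: Es.
Qed.

(** * Towers of chains over a cyclic action *)

Section Tower.
Context {X : Type} (g : X -> X) (k : nat).
Hypothesis gk : forall x, iter k g x = x.

(** The differentials [g - 1] and [1 + g + ... + g ^ (k - 1)] of the periodic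
    resolution, acting on functions of cubes. *)
Definition alt_op (M : zmodType) (n : nat) q (F : cube q X -> M)
    (s : cube q X) : M :=
  if odd n then \sum_(0 <= i < k) F (cmap (iter i g) s)
  else F (cmap g s) - F s.

Definition alt_chain (n : nat) q (c : chain q X) : chain q X :=
  if odd n then flatten [seq chain_map (iter i g) c | i <- index_iota 0 k]
  else chain_map g c ++ chain_opp c.

(** The boundary condition [bd h = D_n h'] is expressed by duality, on normalized
    functions with values in any abelian group. *)
Fixpoint tower (E : X -> X -> Prop) (n : nat) : chain n X -> Prop :=
  match n with
  | 0 => fun h => supported (small E) h /\ ceval h (fun=> 1 : int) = 1
  | n'.+1 => fun h => supported (small E) h /\
      exists2 h' : chain n' X, tower E h' &
        forall (M : zmodType) (F : cube n' X -> M), normalized F ->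
          ceval h (cobd F) = ceval h' (alt_op n' F)
  end.

Lemma tower_supported E n (h : chain n X) : tower E h -> supported (small E) h.
Proof. by case: n h => [|n] h []. Qed.

Section AltOp.
Variable M : zmodType.

Lemma eq_alt_op n q (F F' : cube q X -> M) : F =1 F' -> alt_op n F =1 alt_op n F'.
Proof.
by move=> e s; rewrite /alt_op; case: (odd n); rewrite ?e //; apply: eq_bigr.
Qed.

Lemma ceval_alt n q (c : chain q X) (F : cube q X -> M) :
  ceval (alt_chain n c) F = ceval c (alt_op n F).
Proof.
rewrite /alt_chain /alt_op; case: ifP => _.
  rewrite ceval_flatten big_map ceval_sum.
  by apply: eq_bigr => i _; rewrite ceval_map.
by rewrite ceval_cat ceval_opp ceval_map cevalB.
Qed.

Lemma normalized_alt n q (F : cube q X -> M) :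
  normalized F -> normalized (alt_op n F).
Proof.
move=> nF; rewrite /alt_op; case: (odd n).
  by apply: normalized_sum => i; exact: (@normalized_cmap M q X X).
apply: normalizedD; first exact: (@normalized_cmap M q X X).
by apply: normalized_sub nF => s ->; rewrite oppr0.
Qed.

Lemma cobd_alt n q (F : cube q X -> M) s :
  cobd (alt_op n F) s = alt_op n (cobd F) s.
Proof.
rewrite /alt_op; case: (odd n).
  by rewrite cobd_sum; apply: eq_bigr => i _; rewrite cobd_cmap.
by rewrite cobdB cobd_cmap.
Qed.

Lemma alt_opB n q (F F' : cube q X -> M) s :
  alt_op n (fun t => F t - F' t) s = alt_op n F s - alt_op n F' s.
Proof.
rewrite /alt_op; case: (odd n); first by rewrite -sumrB.
by rewrite [- (F s - _)]opprB [- (F' _ - _)]opprB addrACA [RHS]addrACA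
  [- F' _ - _]addrC.
Qed.

Lemma alt_op_cmap n q (f : X -> X) (F : cube q X -> M) s :
  (forall x, f (g x) = g (f x)) ->
  alt_op n F (cmap f s) = alt_op n (fun t => F (cmap f t)) s.
Proof.
move=> fg; have fgi i x : f (iter i g x) = iter i g (f x).
  by elim: i => //= i <-; rewrite fg.
rewrite /alt_op; case: (odd n).
  by apply: eq_bigr => i _; rewrite !cmap_comp; congr F; apply: eq_cmap.
by rewrite !cmap_comp; congr (F _ - _); apply: eq_cmap.
Qed.

(** Both composites are [g ^ k - 1], by telescoping. *)
Lemma alt_op_alt_op n q (F : cube q X -> M) s : alt_op n (alt_op n.+1 F) s = 0.
Proof.
have tele : \sum_(0 <= i < k)
    (F (cmap (iter i.+1 g) s) - F (cmap (iter i g) s)) = 0.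
  rewrite telescope_sumr // (_ : cmap (iter k g) s = cmap (iter 0 g) s) ?subrr //.
  by apply: eq_cmap => x; exact: gk.
rewrite /alt_op /=; case: (odd n) => /=; rewrite -[RHS]tele.
  by apply: eq_bigr => i _; rewrite cmap_comp.
rewrite -sumrB; apply: eq_bigr => i _; rewrite cmap_comp; congr (F _ - _).
by apply: eq_cmap => x; rewrite iterSr.
Qed.

End AltOp.

Lemma supported_alt n q (c : chain q X) (E : X -> X -> Prop) :
    (forall x y, E x y -> E (g x) (g y)) ->
  supported (small E) c -> supported (small E) (alt_chain n c).
Proof.
move=> Eg; have Eg' i x y : E x y -> E (iter i g x) (iter i g y).
  by move=> xy; elim: i => //= i; exact: Eg.
move=> cE; rewrite /alt_chain; case: ifP => _.
  apply: supported_flatten => i _; apply: supported_map cE => s.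
  by apply: small_cmap => x y; exact: Eg'.
apply: supported_cat; last exact: supported_opp.
by apply: supported_map cE => s; exact: small_cmap.
Qed.

Lemma tower_map (E E' : X -> X -> Prop) (f : X -> X) n (h : chain n X) :
    (forall x, f (g x) = g (f x)) -> (forall x y, E x y -> E' (f x) (f y)) ->
  tower E h -> tower E' (chain_map f h).
Proof.
move=> fg EE'; have sup q (c : chain q X) :
    supported (small E) c -> supported (small E') (chain_map f c).
  by apply: supported_map => s; exact: small_cmap.
elim: n h => [|n IH] h [Eh]; first by rewrite /= ceval_map; split=> //; exact: sup.
move=> [h' /IH th' hh']; split; first exact: sup.
exists (chain_map f h') => // M F nF; rewrite !ceval_map.
under eq_ceval => s do rewrite cobd_cmap.
rewrite hh'; last exact: normalized_cmap.
by apply: eq_ceval => s; rewrite alt_op_cmap.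
Qed.

Section Cone.
Context (H : nat -> X -> X) (m : nat) (y : X).
Hypothesis H0 : forall x, H 0 x = y.

Let prism_op (M : zmodType) q (F : cube q.+1 X -> M) (s : cube q X) : M :=
  \sum_(0 <= j < m) F (@cmap q X (X * X)%type (fun x => (H j x, H j.+1 x)) s).

Let normalized_prism (M : zmodType) q (F : cube q.+1 X -> M) :
  normalized F -> normalized (prism_op F).
Proof.
move=> [_ nF]; apply: normalized_sum => j.
exact: (@normalized_cmap M q X (X * X)%type).
Qed.

Lemma prism_cobd (M : zmodType) q (F : cube q X -> M) (s : cube q X) :
  \sum_(0 <= j < m) (F (cmap (H j.+1) s) - F (cmap (H j) s)) =
  F (cmap (H m) s) - F (cmap (H 0) s).
Proof. by rewrite telescope_sumr. Qed.

Let prism_cobd0 (M : zmodType) (F : cube 0 X -> M) s :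
  prism_op (cobd F) s = F (cmap (H m) s) - F y.
Proof. by rewrite -[in F y](H0 s) -(prism_cobd F). Qed.

Let prism_cobdS (M : zmodType) q (F : cube q.+1 X -> M) s :
  normalized F ->
  prism_op (cobd F) s = F (cmap (H m) s) - cobd (prism_op F) s.
Proof.
move=> nF; rewrite cobd_sum.
have <- : F (cmap (H m) s) - F (cmap (H 0) s) = F (cmap (H m) s).
  rewrite (_ : F (cmap (H 0) s) = 0) ?subr0 // -[RHS](normalized_cst y s nF).
  by congr F; exact: eq_cmap.
rewrite -prism_cobd -sumrB; apply: eq_bigr => j _.
rewrite cobdS /back /front !cmap_comp; congr (_ - _).
exact: (@cobd_cmap M q X (X * X)%type).
Qed.

(** With [K] the prism operator, [bd K + K bd] is the difference of [H m] and of a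
    constant map.  So [bd (K D_n h) = H_m D_n h - K D_n bd h], and the last term
    is [K D_n D_(n - 1) h' = 0].  In dimension [0] the constant map does not
    vanish on normalized functions, but [D_0 = g - 1] kills it. *)
Lemma tower_cone (E E' : X -> X -> Prop) n (h : chain n X) : (0 < m)%N ->
    (forall x, H m (g x) = g (H m x)) ->
    (forall x z, E x z -> E (g x) (g z)) ->
    (forall x z j i i', E x z -> (j < m)%N -> (j <= i <= j.+1)%N ->
       (j <= i' <= j.+1)%N -> E' (H i x) (H i' z)) ->
  tower E h -> tower E' (chain_prism H m (alt_chain n h)).
Proof.
move=> m0 Hmg Eg EE' th.
have Em x z : E x z -> E' (H m x) (H m z).
  by move=> xz; apply: (EE' x z m.-1) => //; rewrite ?prednK ?leqnn ?leq_pred.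
split.
  apply: supported_flatten => j; rewrite mem_index_iota => /andP[_ jm].
  apply: supported_map (supported_alt n Eg (tower_supported th)) => s Es x z.
  move=> [p px xp] [r rz zr].
  have [[x' sx px'] [z' sz rz']] := (vertex_cmap px, vertex_cmap rz).
  have ends (w w' : X) (t : X * X) : t = (H j w', H j.+1 w') ->
      w = t.1 \/ w = t.2 -> exists2 i, (j <= i <= j.+1)%N & w = H i w'.
    by move=> -> [->|->]; [exists j|exists j.+1]; rewrite ?leqnn ?leqnSn.
  have [i ij ->] := ends _ _ _ px' xp; have [i' ij' ->] := ends _ _ _ rz' zr.
  by apply: EE' jm ij ij'; exact: Es.
exists (chain_map (H m) h); first exact: tower_map Em th.
move=> M F nF; rewrite ceval_prism ceval_alt ceval_map.
case: n F h nF th => [|n] F h nF th.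
  apply: eq_ceval => s; rewrite alt_op_cmap //.
  rewrite (eq_alt_op _ (prism_cobd0 F)) alt_opB /alt_op /= subrr subr0 //.
case: th => _ [h' _ hh'].
transitivity (ceval h (alt_op n.+1 (fun s => F (cmap (H m) s)))
   - ceval h (cobd (alt_op n.+1 (prism_op F)))).
  rewrite -cevalB; apply: eq_ceval => s.
  by rewrite (eq_alt_op _ (fun s => prism_cobdS s nF)) alt_opB cobd_alt.
rewrite hh'; last exact/normalized_alt/normalized_prism.
rewrite [X in _ - X](eq_ceval _ (F' := fun=> 0)) ?ceval0 ?subr0; last first.
  by move=> s; exact: alt_op_alt_op.
by apply: eq_ceval => s; rewrite alt_op_cmap.
Qed.

End Cone.

(** [U] is a base of nearness relations: for each one there is a
    finer one that the contraction carries into it. *)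
Lemma tower_exists (U : (X -> X -> Prop) -> Prop) (y : X) :
    (forall E, U E -> forall x, E x x) ->
    (forall E, U E -> forall x z, E x z -> E (g x) (g z)) ->
    (forall E', U E' -> exists2 E, U E & exists (H : nat -> X -> X) (m : nat),
       [/\ (0 < m)%N, forall x, H 0 x = y, forall x, H m (g x) = g (H m x)
         & forall x z j i i', E x z -> (j < m)%N -> (j <= i <= j.+1)%N ->
             (j <= i' <= j.+1)%N -> E' (H i x) (H i' z)]) ->
  forall n E, U E -> exists h : chain n X, tower E h.
Proof.
move=> reflU gU coneU; elim=> [|n IH] E' UE'.
  exists [:: (1, y)]; split; last by rewrite /ceval big_seq1 mulr1z.
  by split=> // x z /= <- <-; exact: reflU.
have [E UE [H [m [m0 H0 Hmg EE']]]] := coneU E' UE'.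
have [h th] := IH E UE.
by exists (chain_prism H m (alt_chain n h)); apply: tower_cone th => //; exact: gU.
Qed.

End Tower.

(** * Chains of an iterated join of copies of Z/k *)

Section JoinChains.
Variable k : nat.
Hypothesis k_gt1 : (1 < k)%N.

(** The augmented chain complex of the join of [C] copies of the discrete set Z/k,
    with colors [0, ..., C - 1].  A simplex of the join of [C'.+1] copies either
    avoids the last copy, or is a simplex of the join of [C'] copies together
    with a vertex of the last copy.  The empty simplex is included. *)
Fixpoint jchain (C : nat) : zmodType :=
  if C is C'.+1 then (jchain C' * {ffun 'Z_k -> jchain C'})%type else int.

Fixpoint bd C : jchain C -> jchain C :=
  match C with
  | 0 => fun=> 0
  | C'.+1 => fun u => (bd u.1 + \sum_h u.2 h, [ffun h => - bd (u.2 h)])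
  end.

Fixpoint jshift C : jchain C -> jchain C :=
  match C with
  | 0 => id
  | C'.+1 => fun u => (jshift u.1, [ffun h => jshift (u.2 (h - 1))])
  end.

(** Adding the vertex [g] of color [i] in front of a simplex.  Simplices
    that already use the color [i] are sent to [0]; for those which use it
    at the vertex [g] this is the usual convention, and the others do not occur
    thanks to [carried]. *)
Fixpoint cone (i : nat) (g : 'Z_k) C : jchain C -> jchain C :=
  match C with
  | 0 => fun=> 0
  | C'.+1 => fun u =>
      if i == C' then (0, [ffun h => u.1 *+ (h == g)])
      else (cone i g u.1, [ffun h => - cone i g (u.2 h)])
  end.

(** The part of a chain on a fundamental domain for the rotation of simplices: the
    simplices whose vertex of highest color is at [0]. *)
Fixpoint fund C : jchain C -> jchain C :=
  match C with
  | 0 => fun=> 0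
  | C'.+1 => fun u => (fund u.1, [ffun h => u.2 h *+ (h == 0)])
  end.

Fixpoint empty_part C : jchain C -> int :=
  match C with
  | 0 => id
  | C'.+1 => fun u => empty_part u.1
  end.

Fixpoint empty_simplex C : jchain C :=
  match C with
  | 0 => 1
  | C'.+1 => (empty_simplex C', 0)
  end.

(** [q] is the number of vertices, so the empty simplex has [q = 0]. *)
Fixpoint homog C (q : nat) : jchain C -> Prop :=
  match C with
  | 0 => fun u => q != 0%N -> u = 0
  | C'.+1 => fun u => homog q u.1 /\
      forall h, if q is q'.+1 then homog q' (u.2 h) else u.2 h = 0
  end.

(** The support lies in the simplex with vertex [a i] in each color [i]. *)
Fixpoint carried C (a : nat -> 'Z_k) : jchain C -> Prop :=
  match C with
  | 0 => fun=> True
  | C'.+1 => fun u => carried a u.1 /\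
      forall h, carried a (u.2 h) /\ (h != a C' -> u.2 h = 0)
  end.

Lemma bd_additive C : zmod_morphism (@bd C).
Proof.
elim: C => [|C IH] u v /=; first by rewrite subr0.
congr (_, _).
  case: u v => [u u'] [v v'] /=.
  rewrite IH opprD [RHS]addrACA -sumrB; congr (_ + _).
  by apply: eq_bigr => h _; rewrite !ffunE.
by apply/ffunP => h; rewrite !ffunE IH opprB opprK addrC.
Qed.
HB.instance Definition _ C :=
  GRing.isZmodMorphism.Build (jchain C) (jchain C) (@bd C) (@bd_additive C).

Lemma shift_additive C : zmod_morphism (@jshift C).
Proof.
elim: C => [//|C IH] u v /=; congr (_, _); first exact: IH.
by apply/ffunP => h; rewrite !ffunE IH.
Qed.
HB.instance Definition _ C :=
  GRing.isZmodMorphism.Build (jchain C) (jchain C) (@jshift C) (@shift_additive C).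

Lemma cone_additive i g C : zmod_morphism (@cone i g C).
Proof.
elim: C => [|C IH] u v /=; first by rewrite subr0.
case: ifP => _; congr (_, _); rewrite ?subr0 ?IH //.
  by apply/ffunP => h; rewrite !ffunE mulrnBl.
by apply/ffunP => h; rewrite !ffunE IH opprB opprK addrC.
Qed.
HB.instance Definition _ i g C :=
  GRing.isZmodMorphism.Build (jchain C) (jchain C) (@cone i g C)
    (@cone_additive i g C).

Lemma fund_additive C : zmod_morphism (@fund C).
Proof.
elim: C => [|C IH] u v /=; first by rewrite subr0.
congr (_, _); first exact: IH.
by apply/ffunP => h; rewrite !ffunE mulrnBl.
Qed.
HB.instance Definition _ C :=
  GRing.isZmodMorphism.Build (jchain C) (jchain C) (@fund C) (@fund_additive C).

Lemma empty_part_additive C : zmod_morphism (@empty_part C).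
Proof. by elim: C => [//|C IH] u v /=; exact: IH. Qed.
HB.instance Definition _ C :=
  GRing.isZmodMorphism.Build (jchain C) int (@empty_part C)
    (@empty_part_additive C).

Lemma bd_bd C (u : jchain C) : bd (bd u) = 0.
Proof.
elim: C u => [//|C IH] u /=; congr (_, _).
  rewrite raddfD /= IH add0r raddf_sum -big_split big1 //= => h _.
  by rewrite ffunE subrr.
by apply/ffunP => h; rewrite !ffunE raddfN /= IH !oppr0.
Qed.

Lemma bd_shift C (u : jchain C) : bd (jshift u) = jshift (bd u).
Proof.
elim: C u => [|C IH] u /=; first by [].
congr (_, _).
  rewrite raddfD /= IH raddf_sum; congr (_ + _).
  rewrite (reindex_inj (addIr 1)); apply: eq_bigr => h _ /=.
  by rewrite ffunE addrK.
by apply/ffunP => h; rewrite !ffunE IH raddfN.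
Qed.

Lemma shift_cone i g C (u : jchain C) :
  jshift (cone i g u) = cone i (g + 1) (jshift u).
Proof.
elim: C u => [//|C IH] u /=; case: ifP => _; congr (_, _); rewrite /= ?raddf0 ?IH //.
  by apply/ffunP => h; rewrite !ffunE raddfMn subr_eq.
by apply/ffunP => h; rewrite !ffunE raddfN /= IH.
Qed.

(** Cones are contractions: on the simplex spanned by the vertices [a i], coning
    with one of the vertices is a null-homotopy of the identity. *)
Lemma bd_cone i (a : nat -> 'Z_k) C (u : jchain C) : (i < C)%N -> carried a u ->
  bd (cone i (a i) u) = u - cone i (a i) (bd u).
Proof.
elim: C u => [//|C IH] [x y] iC /= [ax ay].
have [iC'|iC'] := eqVneq i C.
  rewrite raddf0 add0r; congr (_, _).
    rewrite subr0 (bigD1 (a i)) //= ffunE eqxx big1 ?addr0 // => h /negPf ha.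
    by rewrite ffunE ha.
  apply/ffunP => h; rewrite !ffunE raddfMn.
  have [->|hai] := eqVneq h (a i); last first.
    by rewrite (proj2 (ay h)) -?iC' // subrr oppr0.
  rewrite !mulr1n (bigD1 (a i)) //= big1 ?addr0 => [|h' h'ai].
    by rewrite opprD addrCA subrr addr0.
  by rewrite (proj2 (ay h')) -?iC'.
have iltC : (i < C)%N by rewrite ltn_neqAle iC' -ltnS.
congr (_, _).
  rewrite IH // raddfD raddf_sum /= opprD addrA; congr (_ + _).
  by rewrite -sumrN; apply: eq_bigr => h _; rewrite ffunE.
apply/ffunP => h.
rewrite !ffunE (raddfN (@bd C)) (raddfN (@cone i (a i) C)) /= !opprK.
by rewrite IH //; case: (ay h).
Qed.

Lemma carriedB a C (u v : jchain C) :
  carried a u -> carried a v -> carried a (u - v).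
Proof.
elim: C u v => [//|C IH] [x y] [x' y'] [/= ax ay] [ax' ay']; split; first exact: IH.
move=> h; rewrite !ffunE; case: (ay h) (ay' h) => yh yh0 [yh' yh0'].
by split; [exact: IH|move=> ha; rewrite yh0 ?yh0' // subr0].
Qed.

Lemma carried0 a C : carried a (0 : jchain C).
Proof. by elim: C => [//|C IH]; split=> // h; rewrite ffunE. Qed.

Lemma carried_cone (i : nat) a C (u : jchain C) :
  carried a u -> carried a (cone i (a i) u).
Proof.
elim: C u => [//|C IH] [x y] [ax ay] /=; have [->|_] := eqVneq i C.
  split=> [|h]; first exact: carried0.
  rewrite ffunE; have [_|ha] /= := eqVneq h (a C); first by [].
  by split=> //; exact: carried0.
split=> [|h]; first exact: IH.
rewrite ffunE -sub0r; case: (ay h) => yh yh0; split=> [|ha].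
  by apply: carriedB; [exact: carried0|exact: IH].
by rewrite yh0 // raddf0 subr0.
Qed.

Lemma carried_empty a C : carried a (empty_simplex C).
Proof.
by elim: C => [//|C IH]; split=> // h; rewrite ffunE; split=> //; exact: carried0.
Qed.

Lemma homog_gt C q (u : jchain C) : (C < q)%N -> homog q u -> u = 0.
Proof.
elim: C q u => [|C IH] [|q] u //= Cq; first by move=> ->.
case: u => x y [/= hx hy]; congr (_, _); first by apply: IH hx; exact: ltnW.
by apply/ffunP => h; rewrite ffunE; exact: IH (hy h).
Qed.

Lemma homogB C q (u v : jchain C) : homog q u -> homog q v -> homog q (u - v).
Proof.
elim: C q u v => [|C IH] q u v; first by move=> hu hv q0; rewrite hu ?hv ?subr0.
case: u v => [x y] [x' y'] [/= hx hy] [hx' hy']; split; first exact: IH.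
move=> h; rewrite !ffunE; case: q {hx hx'} hy hy' => [|q] hy hy'.
  by rewrite hy hy' subr0.
by apply: IH; [exact: hy|exact: hy'].
Qed.

Lemma homog0 C q : homog q (0 : jchain C).
Proof.
by elim: C q => [//|C IH] q; split=> // h; rewrite ffunE; case: q.
Qed.

Lemma homogN C q (u : jchain C) : homog q u -> homog q (- u).
Proof. by rewrite -sub0r; apply: homogB; exact: homog0. Qed.

Lemma homogD C q (u v : jchain C) : homog q u -> homog q v -> homog q (u + v).
Proof. by move=> hu hv; rewrite -[v]opprK; apply: homogB => //; exact: homogN. Qed.

Lemma homog_sum C q (I : Type) (r : seq I) (P : pred I) (F : I -> jchain C) :
  (forall i, P i -> homog q (F i)) -> homog q (\sum_(i <- r | P i) F i).
Proof.
move=> hF; apply: (big_ind (@homog C q)) => [|u v hu hv|i Pi].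
- exact: homog0.
- exact: homogD.
- exact: hF.
Qed.

Lemma homog_shift C q (u : jchain C) : homog q u -> homog q (jshift u).
Proof.
elim: C q u => [//|C IH] q [x y] [/= hx hy]; split; first exact: IH.
move=> h; rewrite ffunE; case: q {hx} hy => [|q] hy; last by apply: IH; exact: hy.
by rewrite hy raddf0.
Qed.

Lemma homog_fund C q (u : jchain C) : homog q u -> homog q (fund u).
Proof.
elim: C q u => [|C IH] q u; first by move=> hu q0.
case: u => x y [/= hx hy]; split; first exact: IH.
move=> h; rewrite ffunE; case: (h == 0); first exact: hy.
by case: q {hx hy} => [//|q]; exact: homog0.
Qed.

Lemma homog0_bd C (u : jchain C) : homog 0 u -> bd u = 0.
Proof.
elim: C u => [//|C IH] [x y] [/= hx hy]; rewrite IH // add0r.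
congr (_, _); first by rewrite big1.
by apply/ffunP => h; rewrite !ffunE hy raddf0 oppr0.
Qed.

Lemma homog_bd C q (u : jchain C) : homog q.+1 u -> homog q (bd u).
Proof.
elim: C q u => [//|C IH] q [x y] [/= hx hy]; split=> [|h].
  by apply: homogD; [exact: IH|apply: homog_sum => h _; exact: hy].
rewrite ffunE; case: q {hx} hy => [|q] hy; last by apply/homogN/IH/hy.
by rewrite homog0_bd ?oppr0 //; exact: hy.
Qed.

Lemma homog_cone i g C q (u : jchain C) : homog q u -> homog q.+1 (cone i g u).
Proof.
elim: C q u => [//|C IH] q [x y] [/= hx hy]; case: ifP => _.
  split=> [|h]; first exact: homog0.
  by rewrite ffunE; case: (h == g) => //=; exact: homog0.
split=> [|h]; first exact: IH.
rewrite ffunE; case: q {hx} hy => [|q] hy; last by apply/homogN/IH/hy.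
by rewrite hy raddf0 oppr0; exact: homog0.
Qed.

Lemma homog_empty C : homog 0 (empty_simplex C).
Proof. by elim: C => [//|C IH]; split=> // h; rewrite ffunE. Qed.

Lemma bd_empty C : bd (empty_simplex C) = 0.
Proof. exact/homog0_bd/homog_empty. Qed.

Lemma shift_empty C : jshift (empty_simplex C) = empty_simplex C.
Proof.
elim: C => [//|C IH] /=; rewrite IH; congr (_, _).
by apply/ffunP => h; rewrite !ffunE raddf0.
Qed.

Lemma empty_part_empty C : empty_part (empty_simplex C) = 1.
Proof. by elim: C. Qed.

Lemma empty_part_shift C (u : jchain C) : empty_part (jshift u) = empty_part u.
Proof. by elim: C u => [//|C IH] u; exact: IH. Qed.

Lemma iter_shift C s (x : jchain C) (y : {ffun 'Z_k -> jchain C}) :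
  iter s (@jshift C.+1) (x, y) =
  (iter s (@jshift C) x, [ffun h => iter s (@jshift C) (y (h - s%:R))]).
Proof.
elim: s => [|s IH]; first by congr (_, _); apply/ffunP => h; rewrite ffunE subr0.
rewrite iterS IH /=; congr (_, _); apply/ffunP => h; rewrite !ffunE.
by rewrite -addrA -opprD -mulrS.
Qed.

Lemma iter_shift_k C (u : jchain C) : iter k (@jshift C) u = u.
Proof.
elim: C u => [|C IH] u; first by elim: (k) => //= n ->.
case: u => x y; rewrite iter_shift IH; congr (_, _); apply/ffunP => h.
by rewrite ffunE IH pchar_Zp // subr0.
Qed.

Lemma iter_shift_additive C s : zmod_morphism (iter s (@jshift C)).
Proof. by elim: s => [//|s IH] u v; rewrite /= IH raddfB. Qed.
HB.instance Definition _ C s :=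
  GRing.isZmodMorphism.Build (jchain C) (jchain C) (iter s (@jshift C))
    (@iter_shift_additive C s).

Lemma homog_iter_shift C s q (u : jchain C) :
  homog q u -> homog q (iter s (@jshift C) u).
Proof. by move=> hu; elim: s => //= s; exact: homog_shift. Qed.

(** Every nonempty simplex has a unique translate in the fundamental domain, which
    is to say that the chains in positive degree form a free module. *)
Lemma fund_decomp C q (u : jchain C) : homog q.+1 u ->
  \sum_(0 <= s < k) iter s (@jshift C) (fund (iter (k - s) (@jshift C) u)) = u.
Proof.
elim: C q u => [|C IH] q u.
  move=> -> //; rewrite big1 // => s _.
  by rewrite raddf0.
case: u => x y [/= hx hy].
have pair_sum (r : seq nat) (F : nat -> jchain C)
    (G : nat -> {ffun 'Z_k -> jchain C}) :
  \sum_(s <- r) ((F s, G s) : jchain C.+1) =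
  (\sum_(s <- r) F s, \sum_(s <- r) G s).
  elim: r => [|s r IHr]; first by rewrite !big_nil.
  by rewrite !big_cons IHr.
under eq_bigr => s _ do rewrite iter_shift /= iter_shift.
rewrite pair_sum (IH q) //; congr (_, _); apply/ffunP => h.
rewrite sum_ffunE.
under eq_big_nat => s /andP[_ sk].
  rewrite !ffunE natrB ?(ltnW sk) // pchar_Zp // sub0r opprK subrK.
  rewrite raddfMn /= -iterD subnKC ?(ltnW sk) // iter_shift_k.
  over.
have hk : (h < k)%N by rewrite -[X in (_ < X)%N](Zp_cast k_gt1) ltn_ord.
rewrite (bigD1_seq (h : nat)) /= ?iota_uniq ?mem_index_iota //.
rewrite natr_Zp subrr eqxx mulr1n big1_seq ?addr0 // => s /andP[sh].
rewrite mem_index_iota => /andP[_ sk]; rewrite subr_eq0; case: eqP => // hs.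
by case/eqP: sh; rewrite hs val_Zp_nat // modn_small.
Qed.

Definition alt_mod C n (u : jchain C) : jchain C :=
  if odd n then \sum_(0 <= i < k) iter i (@jshift C) u else jshift u - u.

Lemma alt_modB C n (u v : jchain C) : alt_mod n (u - v) = alt_mod n u - alt_mod n v.
Proof.
rewrite /alt_mod; case: ifP => _; last by rewrite raddfB !opprD addrACA.
by rewrite -sumrB; apply: eq_bigr => i _; rewrite raddfB.
Qed.

Lemma bd_alt_mod C n (u : jchain C) : bd (alt_mod n u) = alt_mod n (bd u).
Proof.
rewrite /alt_mod; case: ifP => _; last by rewrite raddfB /= bd_shift.
rewrite raddf_sum; apply: eq_bigr => i _ /=.
by elim: i => //= i; rewrite bd_shift => ->.
Qed.

(** The periodic resolution is exact on a free module: if [w] is fixed,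
    then [w] is the norm of its part on the fundamental domain.  If the norm
    of [w] vanishes, subtracting from the decomposition of [w] into translates the
    vanishing sum of the untranslated parts leaves terms [g ^ s z - z]. *)
Lemma alt_mod_exact C n q (w : jchain C) : homog q.+1 w -> alt_mod n w = 0 ->
  exists2 v : jchain C, homog q.+1 v & w = alt_mod n.+1 v.
Proof.
move=> hw; rewrite /alt_mod /=; case: (odd n) => /= /eqP.
  rewrite big_nat_rev /=.
  pose z s := fund (iter (k - s) (@jshift C) w).
  have hz s : homog q.+1 (z s) by apply/homog_fund/homog_iter_shift.
  move=> /eqP Nw.
  (* The untranslated parts add up to the fundamental part of the norm. *)
  have z0 : \sum_(0 <= s < k) z s = 0.
    transitivity (fund (jshift
      (\sum_(0 <= i < k) iter (0 + k - i.+1) (@jshift C) w))).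
      2: by rewrite Nw !raddf0.
    rewrite !raddf_sum; apply: eq_big_nat => s /andP[_ sk] /=.
    by rewrite add0n -iterS subnSK.
  exists (\sum_(0 <= s < k) \sum_(0 <= i < s) iter i (@jshift C) (z s)).
    by apply: homog_sum => s _; apply: homog_sum => i _; exact: homog_iter_shift.
  transitivity (\sum_(0 <= s < k) iter s (@jshift C) (z s) - \sum_(0 <= s < k) z s).
    by rewrite z0 subr0 (fund_decomp hw).
  rewrite (raddf_sum (@jshift C)) -!sumrB.
  apply: eq_bigr => s _; rewrite (raddf_sum (@jshift C)) -sumrB /=.
  by rewrite (telescope_sumr (fun i => iter i (@jshift C) (z s))).
rewrite subr_eq0 => /eqP sw; exists (fund w); first exact: homog_fund.
rewrite -[LHS](fund_decomp hw); apply: eq_bigr => s _.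
by congr (iter s _ (fund _)); elim: (k - s)%N => //= i ->.
Qed.

End JoinChains.

(** * From labelled cubes to simplices of the join *)

Section Labelling.
Variable k : nat.
Hypothesis k_gt1 : (1 < k)%N.
Context {X : Type} (g : X -> X) (E : X -> X -> Prop).
Context {C : nat} (color : X -> nat) (label : X -> 'Z_k).
Hypothesis color_lt : forall x, (color x < C)%N.
Hypothesis color_g : forall x, color (g x) = color x.
Hypothesis label_g : forall x, label (g x) = label x + 1.
Hypothesis compat : forall x y, E x y -> color x = color y -> label x = label y.

Let vcone (x : X) : jchain k C -> jchain k C := @cone k (color x) (label x) C.

(** The chain map to the join, built by acyclic carriers: the image of a cube is
    the cone, from the label of its base vertex, over the image of its boundary. *)
Fixpoint simplex (q : nat) : cube q X -> jchain k C :=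
  match q with
  | 0 => fun x => vcone x (empty_simplex k C)
  | q'.+1 => fun s => vcone (base s) (cobd (@simplex q') s)
  end.

Lemma simplexS q (s : cube q.+1 X) :
  simplex s = vcone (base s) (cobd (@simplex q) s).
Proof. by []. Qed.

Lemma homog_simplex q (s : cube q X) : homog q.+1 (simplex s).
Proof.
elim: q s => [|q IH] s; apply: homog_cone; first exact: homog_empty.
by apply: (cobd_closed (Q := fun=> True)) => //; exact: homogB.
Qed.

Lemma simplex_g q (s : cube q X) : simplex (cmap g s) = jshift (simplex s).
Proof.
elim: q s => [|q IH] s.
  by rewrite [RHS]shift_cone shift_empty /= /vcone color_g label_g.
rewrite !simplexS [RHS]shift_cone base_cmap /vcone color_g label_g.
by rewrite cobd_cmap (cobd_morph (@jshift k C)); apply: congr1; exact: eq_cobd.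
Qed.

Lemma normalized_simplex q : normalized (@simplex q).
Proof.
elim: q => [//|q IH]; apply: normalized_sub (normalized_cobd IH) => s.
by rewrite simplexS => ->; rewrite /vcone raddf0.
Qed.

Definition labelled (a : nat -> 'Z_k) (x : X) := label x = a (color x).

Lemma carried_simplex a q (s : cube q X) :
  (forall x, vertex s x -> labelled a x) -> carried a (simplex s).
Proof.
elim: q s => [|q IH] s sa.
  by rewrite /= /vcone (sa s) //; apply: carried_cone; exact: carried_empty.
rewrite simplexS /vcone (sa (base s)); last exact: vertex_base.
by apply/carried_cone/(cobd_closed _ IH) => //; exact: carriedB.
Qed.

Lemma bd_simplex0 (x : cube 0 X) : bd (simplex x) = empty_simplex k C.
Proof.
rewrite /= /vcone (bd_cone (a := fun=> label x)) //; last exact: carried_empty.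
by rewrite bd_empty raddf0 subr0.
Qed.

(** The cone is a null-homotopy on the simplex that carries the cube,
    and the image of the boundary is a cycle by induction. *)
Lemma bd_simplex a q (s : cube q.+1 X) :
    (forall x, vertex s x -> labelled a x) ->
  bd (simplex s) = cobd (@simplex q) s.
Proof.
elim: q s => [|q IH] s sa; rewrite simplexS /vcone (sa (base s));
  try exact: vertex_base.
all: rewrite bd_cone //; last by apply: cobd_closed sa => [|t];
  [exact: carriedB|exact: carried_simplex].
all: rewrite -[RHS]subr0; congr (_ - _); rewrite (cobd_morph (@bd k C)).
  rewrite (eq_cobd (F' := fun=> empty_simplex k C)) => [|t].
    by rewrite /= subrr raddf0.
  exact: bd_simplex0.
rewrite (eq_cobd_in (P := labelled a) (F' := cobd (@simplex q))) //.
by rewrite cobd_cobd raddf0.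
Qed.

Lemma small_labelled q (s : cube q X) : small E s ->
  exists a, forall x, vertex s x -> labelled a x.
Proof.
move=> Es.
(* The color of a vertex determines its label by compatibility. *)
exists (fun i => if pselect (exists x, vertex s x /\ color x = i) is left ex
                 then label (projT1 (cid ex)) else 0).
move=> x sx; rewrite /labelled; case: pselect => [ex|[]]; last by exists x.
by case: cid => y [sy yx]; apply: compat => //; exact: Es.
Qed.

Lemma ceval_alt_op n q (c : chain q X) :
  ceval c (alt_op g k n (@simplex q)) = alt_mod n (ceval c (@simplex q)).
Proof.
have gi i s : simplex (cmap (iter i g) s) = iter i (@jshift k C) (simplex s).
  elim: i s => [|i IH] s; first by rewrite -[in RHS](cmap_id s).
  by rewrite /= -IH -simplex_g cmap_comp.
rewrite /alt_op /alt_mod; case: (odd n).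
  rewrite ceval_sum; apply: eq_bigr => i _.
  by rewrite ceval_morph; apply: eq_ceval => s; exact: gi.
rewrite ceval_morph -cevalB; apply: eq_ceval => s.
by rewrite simplex_g.
Qed.

Lemma homog_ceval q (c : chain q X) : homog q.+1 (ceval c (@simplex q)).
Proof.
elim: c => [|p c IH]; first by rewrite /ceval big_nil; exact: homog0.
rewrite /ceval big_cons; apply: homogD => //.
have hn r : homog q.+1 (simplex p.2 *+ r).
  elim: r => [|r IHr]; first exact: homog0.
  by rewrite mulrS; apply: homogD => //; exact: homog_simplex.
by case: p.1 => r /=; [exact: hn|exact/homogN/hn].
Qed.

(** If [u_n - bd v] is killed by [D_n], exactness gives [u_n = bd v + D_(n - 1) v'],
    and applying [bd] shows that [u_(n - 1) - bd v'] is killed by [D_(n - 1)].  At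
    the bottom [u_0] is a boundary plus a norm, so its augmentation, which
    equals [1], is divisible by [k]. *)
Lemma tower_descent n (h : chain n X) (v : jchain k C) :
    tower g k E h -> homog n.+2 v ->
  alt_mod n (ceval h (@simplex n) - bd v) = 0 -> False.
Proof.
elim: n h v => [|n IH] h v th hv uv0.
  have hw : homog 1 (ceval h (@simplex 0) - bd v).
    by apply: homogB; [exact: homog_ceval|exact: homog_bd].
  have [v' _ wv'] := alt_mod_exact k_gt1 hw uv0.
  have := congr1 (fun w => empty_part (bd w)) wv'.
  rewrite bd_alt_mod /alt_mod /= raddfB /= bd_bd subr0.
  rewrite (ceval_morph (@bd k C)) (ceval_morph (@empty_part k C)).
  rewrite (eq_ceval _ (F' := fun=> 1)) => [|s]; last first.
    rewrite -[LHS]/(empty_part (bd (simplex s))).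
    by rewrite bd_simplex0 empty_part_empty.
  case: th => _ ->; rewrite raddf_sum (eq_bigr (fun=> empty_part (bd v'))).
    rewrite sumr_const_nat subn0 => /(congr1 absz)/eqP.
    rewrite -mulr_natr abszM natz absz_nat eq_sym muln_eq1.
    by rewrite [k == _]gtn_eqF // andbF.
  by move=> i _ /=; elim: i => //= i IHi; rewrite empty_part_shift.
case: th => Eh [h' th' hh'].
have hw : homog n.+2 (ceval h (@simplex n.+1) - bd v).
  by apply: homogB; [exact: homog_ceval|exact: homog_bd].
have [v' hv' wv'] := alt_mod_exact k_gt1 hw uv0.
apply: (IH h' v') => //.
have := congr1 (@bd k C) wv'.
rewrite bd_alt_mod raddfB /= bd_bd subr0 (ceval_morph (@bd k C)).
rewrite (eq_ceval_in (F' := cobd (@simplex n)) Eh); last first.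
  by move=> s /small_labelled[a]; exact: bd_simplex.
rewrite hh'; last exact: normalized_simplex.
rewrite ceval_alt_op alt_modB => ->.
by rewrite /alt_mod /= negbK subrr.
Qed.

(** A simplex of the join has at most [C] vertices, while the image of a
    [C]-cube has degree [C.+1]. *)
Lemma no_tower (h : chain C X) : tower g k E h -> False.
Proof.
move=> th; apply: (tower_descent (v := 0) th); first exact: homog0.
rewrite raddf0 subr0 (_ : ceval h _ = 0); last exact: homog_gt (homog_ceval _).
by rewrite -[X in alt_mod _ X](subrr 0) alt_modB subrr.
Qed.

End Labelling.

(** * Labels on a free orbit space *)

Section OrbitLabels.
Variable k : nat.
Hypothesis k_gt1 : (1 < k)%N.

Lemma Zp_ltn (s : 'Z_k) : (s < k)%N.
Proof. by rewrite -[X in (_ < X)%N](Zp_cast k_gt1) ltn_ord. Qed.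

(** Choosing a representative of each orbit, freeness makes the position relative
    to the representative well defined modulo [k]. *)
Lemma orbit_labels (T : Type) (g : T -> T) :
    (forall x, iter k g x = x) ->
    (forall x s, (s < k)%N -> iter s g x = x -> s = 0%N) ->
  exists (label : T -> 'Z_k) (rep : T -> T),
    [/\ forall x, label (g x) = label x + 1, forall x, rep (g x) = rep x
      & forall x, x = iter (label x) g (rep x)].
Proof.
move=> gk free.
have gmod n x : iter n g x = iter (n %% k) g x.
  rewrite {1}(divn_eq n k) iterD; elim: (n %/ k)%N => [//|q IH].
  by rewrite mulSn iterD gk.
have ginj n x y : iter n g x = iter n g y -> x = y.
  (* The inverse of a power of g is another power. *)
  have gn z : iter (k - n %% k) g (iter n g z) = z.
    by rewrite [iter n g z]gmod -iterD subnK ?gk // ltnW // ltn_mod ltnW.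
  by move=> /(congr1 (iter (k - n %% k) g)); rewrite !gn.
have gS (s : 'Z_k) x : iter (s + 1 : 'Z_k)%R g x = g (iter s g x).
  rewrite -iterS (gmod s.+1); congr iter.
  by rewrite -(val_Zp_nat k_gt1 s.+1) -natr1 natr_Zp.
have uniq (s t : 'Z_k) x : iter s g x = iter t g x -> s = t.
  wlog st : s t / (s <= t)%N => [hw|].
    by have [|/ltnW] := leqP s t => h e; [|apply/esym]; exact: hw.
  move=> e; apply/val_inj/eqP; rewrite eqn_leq st /= -subn_eq0; apply/eqP.
  apply: (free (iter s g x)); first by rewrite (leq_ltn_trans (leq_subr _ _)) ?Zp_ltn.
  by rewrite -iterD subnK.
pose orb x := [set y | exists s : 'Z_k, x = iter s g y].
have orbg x : orb (g x) = orb x.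
  apply/seteqP; split=> y [s xs].
    by exists (s - 1); apply: (ginj 1%N); rewrite -[RHS](gS (s - 1)) subrK.
  by exists (s + 1); rewrite gS -xs.
have orbx x : orb x x by exists 0.
(* The representative depends on the point only through its orbit. *)
pose rep x : T := xget (x : {classic T}) (orb x : set {classic T}).
have repP x : orb x (rep x).
  by rewrite /rep; case: xgetP => // /(_ x).
have repg x : rep (g x) = rep x.
  rewrite /rep orbg /xget; case: pselect => // -[].
  by exists x; apply/asboolP; exact: orbx.
exists (fun x => projT1 (cid (repP x))), rep; split=> // [x|x].
  case: cid => s /= xs; case: cid => t /= xt.
  apply: (uniq _ _ (rep x)); rewrite gS -xt xs repg //.
by case: cid.
Qed.

End OrbitLabels.

(** * Analytic preliminaries and characters *)

Section Analysis.
Context {R : realType}.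
Local Notation C := R[i].
Local Notation Re := complex.Re.
Local Notation Im := complex.Im.

Lemma complex_ltP (x y : C) : 0 <= x -> 0 <= y -> x < y \/ y <= x.
Proof.
move=> x0 y0; have := real_ltP (ger0_real x0) (ger0_real y0).
by case=> h; [left|right].
Qed.

Lemma positive_lower_bound (I : finType) (f : I -> C) :
  (forall i, 0 < f i) -> exists2 c, 0 < c & forall i, c <= f i.
Proof.
move=> f0; pose S := 1 + \sum_i (f i)^-1.
have S0 : 0 < S by rewrite ltr_wpDr // sumr_ge0 // => i _; rewrite invr_ge0 ltW.
exists S^-1 => [|i]; first by rewrite invr_gt0.
rewrite -[leRHS]invrK lef_pV2 ?posrE ?invr_gt0 //.
rewrite /S (bigD1 i) //= addrCA lerDl addr_ge0 // sumr_ge0 // => j _.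
by rewrite invr_ge0 ltW.
Qed.

Lemma complex_expr_small (r e : C) : 0 <= r -> r < 1 -> 0 < e ->
  \forall n \near \oo, r ^+ n < e.
Proof.
move=> r0 r1 e0.
have rE : r = (Re r)%:C%C by rewrite RRe_real // ger0_real.
have eE : e = (Re e)%:C%C by rewrite RRe_real // gtr0_real.
have Rr1 : `|Re r| < 1.
  by move: r1 r0; rewrite rE -[1]/(1%:C)%C ltcR ler0c => r1 r0; rewrite ger0_norm.
have Re0 : 0 < Re e by move: e0; rewrite eE -[0]/(0%:C)%C ltcR.
have := cvg_expr Rr1 => /cvgrPdist_lt /(_ _ Re0).
apply: filterS => n; rewrite sub0r normrN => h.
rewrite rE eE -rmorphXn ltcR /=; exact: le_lt_trans (ler_norm _) h.
Qed.

(** Cutting the plane into squares of side [e / 2]. *)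
Lemma finite_coloring (M e : C) : 0 < e ->
  exists (T : finType) (color : C -> T), forall z w, `|z| <= M -> `|w| <= M ->
    color z = color w -> `|z - w| < e.
Proof.
move=> e0; have eE : e = (Re e)%:C%C by rewrite RRe_real // gtr0_real.
pose d := Re e / 2; pose m := Re M.
have d0 : 0 < d by rewrite divr_gt0 //; move: e0; rewrite eE -[0]/(0%:C)%C ltcR.
pose cell (r : R) := Num.truncn ((r + m) / d).
pose K := Num.truncn ((m + m) / d).
exists ('I_K.+1 * 'I_K.+1)%type.
exists (fun z => (inord (cell (Re z)), inord (cell (Im z)))).
have cellP r s : `|r| <= m -> `|s| <= m ->
    inord (cell r) = inord (cell s) :> 'I_K.+1 -> `|r - s| < d.
  move=> rm sm; have cellK t : `|t| <= m -> (cell t < K.+1)%N.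
    move=> tm; rewrite ltnS truncn_le_nat (le_lt_trans _ (truncnS_gt _)) //.
    by rewrite ler_pM2r ?invr_gt0 // lerD2r (le_trans (ler_norm _)).
  move=> /(congr1 val) /=; rewrite !inordK ?cellK // /cell => rs.
  have pos t : `|t| <= m -> 0 <= (t + m) / d.
    rewrite ler_norml => /andP[tm _].
    by rewrite divr_ge0 ?(ltW d0) // -lerBlDr sub0r.
  have /andP[r1 r2] := truncn_itv (pos r rm).
  have /andP[s1 s2] := truncn_itv (pos s sm).
  have : `|(r + m) / d - (s + m) / d| < 1.
    rewrite ltr_norml; move: r1 r2 s1 s2; rewrite rs -natr1.
    by move=> r1 r2 s1 s2; apply/andP; split; lra.
  rewrite -mulrBl opprD addrACA subrr addr0 normrM normfV (gtr0_norm d0).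
  by rewrite ltr_pdivrMr ?mul1r.
have bound (z : C) : `|z| <= M -> `|Re z| <= m /\ `|Im z| <= m.
  move=> zM; have Re_le w : `|w| <= M -> `|Re w| <= m.
    move=> wM; have := le_trans (normc_ge_Re w) wM.
    by rewrite lecE => /andP[_].
  have normi : `|'i%C| = 1 :> C by rewrite normc_def /= expr0n expr1n add0r sqrtr1.
  split; first exact: Re_le.
  by rewrite -normrN -ReiNIm; apply: Re_le; rewrite normrM normi mulr1.
move=> z w /bound[zr zi] /bound[wr wi] [/(cellP _ _ zr wr) re /(cellP _ _ zi wi) im].
have normi : `|'i%C| = 1 :> C by rewrite normc_def /= expr0n expr1n add0r sqrtr1.
rewrite [z - w]complexE (le_lt_trans (ler_normD _ _)) // normrM normi mul1r.
have normR (x : R) : `|x%:C%C| = `|x|%:C%C :> C.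
  by rewrite normc_def /= expr0n addr0 sqrtr_sqr.
by rewrite !normR !raddfB -rmorphD eE ltcR [ltRHS]splitr ltrD.
Qed.

Lemma continuous_ui (V : normedModType C) (f : unit_interval R -> V)
    (u : unit_interval R) (e : C) : continuous f -> 0 < e ->
  exists2 d : R, 0 < d & forall v : unit_interval R,
    `|set_val u - set_val v| < d -> `|f u - f v| < e.
Proof.
move=> fc e0; have := fc u => /cvgrPdist_lt /(_ _ e0).
rewrite near_simpl => -[_ /= [[W oW <-] /= Wu] Wf].
move: oW; rewrite openE /= => /(_ _ Wu) /nbhs_ballP[d /= d0 dW].
by exists d => // v uv; apply: Wf; apply: dW.
Qed.

(** With the inverse of the mesh tending to infinity as a parameter, this is an
    instance of the near-covering form of compactness. *)
Lemma uniformly_continuous_ui (V : normedModType C) (f : unit_interval R -> V)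
    (e : C) :
    continuous f -> 0 < e ->
  \forall m \near \oo, forall u v : unit_interval R,
    `|set_val u - set_val v| <= (m.+1%:R)^-1 -> `|f u - f v| < e.
Proof.
move=> fc e0.
have /compact_near_coveringP := @segment_compact R 0 1.
move=> /(_ nat \oo (fun m x => forall u v : unit_interval R, set_val u = x ->
   `|set_val u - set_val v| <= (m.+1%:R)^-1 -> `|f u - f v| < e)).
case=> [x x01|N NN P]; last first.
  by exists N => // m Nm u v uv; apply: (P m Nm _ _ u v) => //; exact/set_mem/(valP u).
pose u0 : unit_interval R := exist _ x (mem_set x01).
have e20 : 0 < e / 2 by rewrite divr_gt0.
have [d d0 fd] := continuous_ui u0 fc e20.
have d20 : 0 < d / 2 by rewrite divr_gt0.
near=> x' m => /= u v ux' uv.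
have xx' : `|x - x'| < d / 2 by near: x'; exact: cvgr_dist_lt.
have md : (m.+1%:R)^-1 < d / 2.
  near: m; exact: near_infty_natSinv_lt (PosNum d20).
rewrite -(subrK (f u0) (f u)) -addrA (le_lt_trans (ler_normD _ _)) //.
rewrite [ltRHS]splitr ltrD // ?(distrC (f u)); apply: fd => /=.
  by rewrite ux' (lt_trans xx') // ltr_pdivrMr // mulr2n mulrDr mulr1 ltrDl.
rewrite (le_lt_trans (ler_distD x' _ _)) // [ltRHS]splitr ltrD //.
by rewrite -ux' (le_lt_trans uv).
Unshelve. all: by end_near. Qed.

Lemma norm_expr_le (A : cstarAlgType R) (b : A) n : `|b ^+ n| <= `|b| ^+ n.
Proof.
elim: n => [|n IH]; last first.
  by rewrite !exprS (le_trans (normrM_le _ _)) // ler_wpM2l.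
have n0 : `|1 : A| != 0 by rewrite normr_eq0 oner_eq0.
rewrite !expr0 le_eqVlt -(inj_eq (mulfI n0)) mulr1 -expr2 -norm_starM star1 mulr1.
by rewrite eqxx.
Qed.

(** The geometric series; this is where completeness of the algebra is used. *)
Lemma neumann (A : cstarAlgType R) (b : A) : `|b| < 1 -> exists d, (1 - b) * d = 1.
Proof.
move=> b1; pose u := series (fun i => b ^+ i).
have uE n : (1 - b) * u n = 1 - b ^+ n.
  rewrite /u /series /=; elim: n => [|n IH].
    by rewrite big_geq // mulr0 expr0 subrr.
  by rewrite big_nat_recr //= mulrDr IH mulrBl mul1r -exprS addrA subrK.
have r0 : 0 < 1 - `|b| by rewrite subr_gt0.
have tail m n : (m <= n)%N -> (1 - `|b|) * \sum_(m <= i < n) `|b| ^+ i <= `|b| ^+ m.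
  move=> mn; rewrite mulr_sumr.
  under eq_bigr => i _ do rewrite mulrBl mul1r -exprS.
  rewrite -[leRHS]subr0 (eq_bigr (fun i => - (`|b| ^+ i.+1 - `|b| ^+ i))).
    by rewrite sumrN telescope_sumr // opprB lerD2l lerN2 exprn_ge0.
  by move=> i _; rewrite opprB.
have b0 e : 0 < e -> \forall n \near \oo, `|b| ^+ n < e.
  exact: complex_expr_small.
have uc : cvg (u @ \oo).
  apply/cauchy_cvgP/cauchy_seriesP => e e0.
  have [N _ NP] := b0 _ (mulr_gt0 r0 e0).
  exists ([set n | N <= n], [set n | N <= n])%N; first by split; exists N.
  move=> [m n] /= [Nm _]; have [nm|/ltnW mn] := leqP n m.
    by rewrite big_geq // normr0.
  rewrite -(ltr_pM2l r0); apply: le_lt_trans (NP m Nm); apply: le_trans (tail _ _ mn).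
  rewrite ler_wpM2l ?(ltW r0) // (le_trans (ler_norm_sum _ _ _)) //.
  by apply: ler_sum => i _; exact: norm_expr_le.
exists (lim (u @ \oo)).
have h1 : (1 - b) * u n @[n --> \oo] --> (1 - b) * lim (u @ \oo).
  by apply: cvgM_cstar => //; exact: cvg_cst.
have h2 : (1 - b) * u n @[n --> \oo] --> (1 : A).
  apply/cvgrPdist_lt => e e0; have := b0 e e0; apply: filterS => n.
  by rewrite uE opprB addrC subrK; apply: le_lt_trans; exact: norm_expr_le.
exact: (cvg_unique (@norm_hausdorff _ A) h1 h2).
Qed.

Definition is_char (A : cstarAlgType R) (x : A -> C) :=
  [/\ forall c a b, x (c *: a + b) = c * x a + x b, x 1 = 1
    & forall a b, x (a * b) = x a * x b].

Section Characters.
Context (A : cstarAlgType R) (x : A -> C).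
Hypothesis xP : is_char x.

Lemma char0 : x 0 = 0.
Proof.
by have [xl _ _] := xP; have := xl (-1) 0 0; rewrite scaler0 addr0 mulN1r addNr.
Qed.

Lemma charZ c a : x (c *: a) = c * x a.
Proof. by have [xl _ _] := xP; rewrite -[c *: a]addr0 xl char0 addr0. Qed.

Lemma charD a b : x (a + b) = x a + x b.
Proof. by have [xl _ _] := xP; rewrite -[a]scale1r xl mul1r scale1r. Qed.

Lemma charB a b : x (a - b) = x a - x b.
Proof. by rewrite -scaleN1r charD charZ mulN1r. Qed.

Lemma char_sum (I : Type) (r : seq I) (P : pred I) (F : I -> A) :
  x (\sum_(i <- r | P i) F i) = \sum_(i <- r | P i) x (F i).
Proof. exact: (big_morph x charD char0). Qed.

(** A character cannot take the value [1] at an element [b] of norm below [1],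
    since [1 - b] has a right inverse. *)
Lemma char_norm a : `|x a| <= `|a|.
Proof.
have [_ x1 xM] := xP; case: (complex_ltP (normr_ge0 a) (normr_ge0 (x a))) => // ltx.
have xa0 : x a != 0 by rewrite -normr_gt0 (le_lt_trans _ ltx).
have : `|(x a)^-1 *: a| < 1.
  by rewrite normrZ normfV mulrC ltr_pdivrMr ?normr_gt0 // mul1r.
case/neumann => d /(congr1 x); rewrite xM x1 charB x1 charZ mulVf // subrr mul0r.
by move/esym/eqP; rewrite oner_eq0.
Qed.

End Characters.
End Analysis.

(** * The character of Z/k given by a primitive root of unity *)

Section RootOfUnity.
Context {R : realType} (k : nat).
Hypothesis k_gt1 : (1 < k)%N.
Local Notation w := (omega R k).

Lemma omegaX n :
  w ^+ n = Complex (cos (2 * pi / k%:R *+ n)) (sin (2 * pi / k%:R *+ n)).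
Proof.
rewrite /omega; set a : R := 2 * pi / k%:R.
elim: n => [|n IH]; first by rewrite expr0 mulr0n cos0 sin0.
rewrite exprS IH mulrS cosD sinD; apply/eqP; rewrite eq_complex /=.
by rewrite eqxx addrC [X in _ + X]mulrC eqxx.
Qed.

Lemma omega_k : w ^+ k = 1.
Proof.
have k0 : k%:R != 0 :> R by rewrite pnatr_eq0 -lt0n ltnW.
rewrite omegaX -mulr_natr divfK // mulr_natl cos2pi.
by rewrite -[pi *+ 2]add0r sinD2pi sin0.
Qed.

Lemma omega_mod n : w ^+ (n %% k) = w ^+ n.
Proof. by rewrite {2}(divn_eq n k) exprD mulnC exprM omega_k expr1n mul1r. Qed.

Lemma norm_omega n : `|w ^+ n| = 1.
Proof. by rewrite omegaX normc_def /= cos2Dsin2 sqrtr1. Qed.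

(** [cos (2 x) = 1] forces [sin x = 0], which is excluded for [0 < x < pi]. *)
Lemma omega_neq1 s : (0 < s < k)%N -> w ^+ s != 1.
Proof.
move=> /andP[s0 sk]; rewrite omegaX eq_complex /= negb_and; apply/orP; left.
pose x : R := pi / k%:R *+ s.
have k0 : 0 < k%:R :> R by rewrite ltr0n ltnW.
have -> : 2 * pi / k%:R *+ s = x *+ 2 by rewrite /x -mulrA mulr_natl mulrnAC.
rewrite cos_mulr2n cos2sin2; apply/negP => /eqP h.
have : 0 < sin x.
  apply: sin_gt0_pi; rewrite /x -mulr_natr.
  rewrite mulr_gt0 ?divr_gt0 ?pi_gt0 ?ltr0n ?(ltnW k_gt1) //=.
  by rewrite mulrAC ltr_pdivrMr // ltr_pM2l ?pi_gt0 // ltr_nat.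
move/(exprn_gt0 2); lra.
Qed.

Definition omega_char (g : 'Z_k) : R[i] := w ^+ g.

Lemma omega_charD : {morph omega_char : g h / g + h >-> g * h}.
Proof.
move=> g h; rewrite /omega_char -exprD -[RHS]omega_mod; congr (_ ^+ _).
by rewrite -[RHS](val_Zp_nat k_gt1) natrD !natr_Zp.
Qed.

Lemma omega_char_is_character : is_character omega_char.
Proof.
split; [exact: expr0|exact: omega_charD|by move=> g; exact: norm_omega].
Qed.

Lemma omega_char_separated : exists2 c : R[i], 0 < c &
  forall s t : 'Z_k, s != t -> c <= `|omega_char s - omega_char t|.
Proof.
have [|c c0 cP] := @positive_lower_bound R 'Z_k
  (fun s => if s == 0 then 1 else `|omega_char s - 1|).
  move=> s; case: eqP => // s0; rewrite normr_gt0 subr_eq0 omega_neq1 //.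
  by rewrite Zp_ltn // andbT lt0n; apply/eqP => e; apply/s0/val_inj.
exists c => // s t st; have := cP (s - t); rewrite subr_eq0 (negPf st).
have -> : omega_char s - omega_char t = (omega_char (s - t) - 1) * omega_char t.
  by rewrite mulrBl mul1r -omega_charD subrK.
by rewrite normrM norm_omega mulr1.
Qed.

End RootOfUnity.

(** * Characters of the crossed product *)

Section CrossedCharacters.
Context {R : realType} {k : nat} {A : cstarAlgType R}.
Context {beta : star_action 'Z_k A} {B : crossed_product beta}.
Local Notation C := R[i].
Local Notation emb := (cp_emb B).
Local Notation mu := (cp_unit B).

Lemma emb_linear c a b : emb (c *: a + b) = c *: emb a + emb b.
Proof. by have [h _ _] := cp_emb_hom B; exact: h. Qed.

Lemma emb0 : emb 0 = 0.
Proof.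
by have := emb_linear (-1) 0 0; rewrite scaler0 addr0 scaleN1r addNr.
Qed.

Lemma embZ c a : emb (c *: a) = c *: emb a.
Proof. by rewrite -[c *: a]addr0 emb_linear emb0 addr0. Qed.

Lemma emb1 : emb 1 = 1.
Proof. by have [_ [h _] _] := cp_emb_hom B. Qed.

Lemma embM a b : emb (a * b) = emb a * emb b.
Proof. by have [_ [_ h] _] := cp_emb_hom B; exact: h. Qed.

Lemma cp_coefP (b : B) (a : 'Z_k -> A) : b = \sum_j emb (a j) * mu j -> cp_coef b = a.
Proof. by move=> ->; exact: cp_coef_sum. Qed.

Lemma cp_coef_linear c (b b' : B) :
  cp_coef (c *: b + b') = fun j => c *: cp_coef b j + cp_coef b' j.
Proof.
apply: cp_coefP; rewrite -{1}(cp_coefK b) -{1}(cp_coefK b') scaler_sumr -big_split.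
by apply: eq_bigr => j _; rewrite emb_linear mulrDl scalerAl.
Qed.

Lemma cp_coef_monomial a m :
  cp_coef (emb a * mu m) = fun j => if j == m then a else 0.
Proof.
apply: cp_coefP; rewrite (bigD1 m) //= eqxx big1 ?addr0 // => j /negPf ->.
by rewrite emb0 mul0r.
Qed.

Lemma cp_coef_extend (theta : star_action 'Z_k A) g (b : B) :
  cp_coef (cp_extend theta g b) = fun j => theta g (cp_coef b j).
Proof. exact: cp_coefP. Qed.

Lemma cp_coef_dual g (b : B) :
  cp_coef (cp_dual g b) = fun j => omega R k ^+ (j * g)%N *: cp_coef b j.
Proof. by apply: cp_coefP; apply: eq_bigr => j _; rewrite embZ scalerAl. Qed.

Lemma cp_coef_emb a : cp_coef (emb a) = fun j => if j == 0 then a else 0.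
Proof. by rewrite -cp_coef_monomial cp_unit0 mulr1. Qed.

Lemma monomialM a b l m :
  (emb a * mu l) * (emb b * mu m) = emb (a * beta l b) * mu (l + m).
Proof.
rewrite embM -(cp_covariant B) cp_unitD !mulrA; congr (_ * _).
by rewrite -[RHS]mulrA (cp_unitary B l).1 mulr1.
Qed.

(** The extension of [x] to the crossed product that sends the unitaries to
    [1]. *)
Definition total_coef (x : A -> C) (b : B) : C := \sum_j x (cp_coef b j).

Section Invariant.
Variable x : A -> C.
Hypothesis xP : is_char x.
Hypothesis x_beta : forall g a, x (beta g a) = x a.

Lemma total_coef_monomial a m : total_coef x (emb a * mu m) = x a.
Proof.
rewrite /total_coef cp_coef_monomial (bigD1 m) //= eqxx big1 ?addr0 // => j /negPf ->.
exact: char0.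
Qed.

Lemma total_coef_linear c (b b' : B) :
  total_coef x (c *: b + b') = c * total_coef x b + total_coef x b'.
Proof.
rewrite /total_coef cp_coef_linear mulr_sumr -big_split; apply: eq_bigr => j _.
by case: xP => ->.
Qed.

Lemma total_coef_sum (I : finType) (F : I -> B) :
  total_coef x (\sum_i F i) = \sum_i total_coef x (F i).
Proof.
have D u v : total_coef x (u + v) = total_coef x u + total_coef x v.
  by rewrite -[u]scale1r total_coef_linear mul1r scale1r.
apply: (big_morph _ D).
have := total_coef_linear (-1) 0 0.
by rewrite scaler0 addr0 mulN1r addNr.
Qed.

(** Invariance of [x] under [beta] makes the trivial character of the group
    compatible with it: a covariant pair of characters. *)
Lemma total_coef_char : is_char (total_coef x).
Proof.
split; first exact: total_coef_linear.
  rewrite -[X in total_coef x X](cp_unit0 B) -[mu 0]mul1r -emb1 total_coef_monomial.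
  by case: xP.
move=> b b'; rewrite -{1}(cp_coefK b) -{1}(cp_coefK b') mulr_suml total_coef_sum.
rewrite /total_coef mulr_suml; apply: eq_bigr => l _; rewrite mulr_sumr.
rewrite -/(total_coef x _) total_coef_sum mulr_sumr; apply: eq_bigr => m _.
by rewrite monomialM total_coef_monomial; case: xP => _ _ ->; rewrite x_beta.
Qed.

End Invariant.

Lemma cp_coef_group (c : 'Z_k -> C) :
  cp_coef (\sum_j c j *: mu j) = fun j => c j *: 1.
Proof.
by apply: cp_coefP; apply: eq_bigr => j _; rewrite embZ emb1 -scalerAl mul1r.
Qed.

(** Some functional with the value [c] at [c *: 1]; it will only be applied
    to coefficients of elements of the group algebra, which are scalars. *)
Definition scalar_value (a : A) : C := xget 0 [set c | a = c *: 1].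

Lemma scalar_valueE c : scalar_value (c *: 1) = c.
Proof.
rewrite /scalar_value; case: xgetP => [d -> /eqP|/(_ c)[]//].
rewrite -subr_eq0 -scalerBl scaler_eq0 oner_eq0 orbF subr_eq0.
by move/eqP.
Qed.

(** The trivial character of the group algebra.  Using [scalar_value] rather than
    a character of [A] is essential: it serves to produce the first one. *)
Definition group_sum (b : B) : C := total_coef scalar_value b.

Lemma group_sumE c : group_sum (\sum_j c j *: mu j) = \sum_j c j.
Proof.
by rewrite /group_sum /total_coef cp_coef_group; apply: eq_bigr => j _;
  exact: scalar_valueE.
Qed.

Lemma total_coef_group x b : is_char x -> cp_group b -> total_coef x b = group_sum b.
Proof.
move=> xP [c ->]; rewrite group_sumE /total_coef cp_coef_group.
by apply: eq_bigr => j _; rewrite charZ //; case: xP => _ -> _; rewrite mulr1.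
Qed.

Lemma group_sum_linear c b b' : cp_group b -> cp_group b' ->
  group_sum (c *: b + b') = c * group_sum b + group_sum b'.
Proof.
move=> [d ->] [e ->]; rewrite !group_sumE scaler_sumr -big_split.
rewrite (eq_bigr (fun j => (c * d j + e j) *: mu j)) => [|j _].
  by rewrite group_sumE mulr_sumr -big_split.
by rewrite scalerDl scalerA.
Qed.

Lemma group_sumM b b' : cp_group b -> cp_group b' ->
  group_sum (b * b') = group_sum b * group_sum b'.
Proof.
move=> [d ->] [e ->]; rewrite !group_sumE.
have -> : (\sum_j d j *: mu j) * (\sum_j e j *: mu j) =
    \sum_m (\sum_l d l * e (m - l)) *: mu m.
  rewrite mulr_suml; under [RHS]eq_bigr => m _ do rewrite scaler_suml.
  rewrite exchange_big; apply: eq_bigr => l _; rewrite mulr_sumr.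
  rewrite [RHS](reindex_inj (addrI l)); apply: eq_bigr => m _ /=.
  by rewrite addrAC subrr add0r cp_unitD -scalerAl -scalerAr scalerA.
rewrite group_sumE exchange_big mulr_suml; apply: eq_bigr => l _.
rewrite mulr_sumr (reindex_inj (addrI l)); apply: eq_bigr => m _ /=.
by rewrite addrAC subrr add0r.
Qed.

Lemma group_sum1 : group_sum 1 = 1.
Proof.
rewrite /group_sum /total_coef -emb1 cp_coef_emb (bigD1 0) //=.
rewrite -[X in scalar_value X]scale1r.
rewrite scalar_valueE big1 ?addr0 // => j /negPf ->.
by rewrite -(scale0r 1) scalar_valueE.
Qed.

End CrossedCharacters.

(** * The flow on invariant characters *)

(** A finite sum of products [a * star b] within [1 / 2] of [1] has values of
    modulus greater than [1 / 2] under all characters, so one of the factors [a]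
    must have a value bounded away from [0]. *)
Lemma isotypic_lower_bound {R : realType} {G : zmodType} {A : cstarAlgType R}
    (alpha : star_action G A) (chi : G -> R[i]) :
    free_action alpha -> is_character chi ->
  exists n (a : 'I_n -> A) (d : R[i]),
    [/\ 0 < d, forall i, isotypic alpha chi (a i)
      & forall x, is_char x -> exists i, d <= `|x (a i)|].
Proof.
move=> free chiP; have h2 : 0 < 2^-1 :> R[i] by rewrite invr_gt0.
have := free chi chiP _ (nbhsx_ballx (1 : A) _ h2).
move=> [_ [[n [c [s [sP ->]]]]]]; rewrite -ball_normE /= => near1.
have [a aP] := choice sP; have [b abP] := choice aP.
pose D := 1 + \sum_i `|c i| * `|star (b i)|.
have D0 : 0 < D by rewrite ltr_wpDr // sumr_ge0.
exists n, a, (2 * D)^-1; split=> [|i|x xP]; first by rewrite invr_gt0 mulr_gt0.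
  by case: (abP i).
apply: contrapT => /forallNP small.
have : `|x 1 - x (\sum_i c i *: s i)| < 2^-1.
  by rewrite -charB // (le_lt_trans (char_norm xP _)).
have : `|x (\sum_i c i *: s i)| <= 2^-1.
  rewrite char_sum // (le_trans (ler_norm_sum _ _ _)) //.
  apply: (@le_trans _ _ (\sum_i `|c i| * `|star (b i)| * (2 * D)^-1)).
    apply: ler_sum => i _; case: (abP i) => _ _ ->.
    rewrite charZ //; have [_ _ ->] := xP.
    rewrite !normrM [_ * `|x (star _)|]mulrC mulrA.
    apply: ler_pM => //.
      by rewrite ler_wpM2l // char_norm.
    have i0 : 0 <= (2 * D)^-1 by rewrite invr_ge0 mulr_ge0 // ltW.
    by case: (complex_ltP (normr_ge0 (x (a i))) i0) => [/ltW //|/small].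
  rewrite -mulr_suml invfM mulrCA ger_pMr // ler_pdivrMr // mul1r.
  by rewrite /D lerDr.
have [_ -> _] := xP => le2 lt2.
have := ler_normD (1 - x (\sum_i c i *: s i)) (x (\sum_i c i *: s i)).
rewrite subrK normr1 => /le_lt_trans /(_ (ltr_leD lt2 le2)).
by rewrite (_ : 2^-1 + 2^-1 = 1) ?ltxx // [RHS]splitr mul1r.
Qed.

Section Flow.
Context {R : realType} {k : nat} {A : cstarAlgType R}.
Context {alpha beta : star_action 'Z_k A} {B : crossed_product beta}.
Local Notation C := R[i].
Hypothesis k_gt1 : (1 < k)%N.
Hypothesis alpha_beta : commuting alpha beta.
Variable phi : A -> twisted_join B.
Hypothesis phi_hom : unital_star_hom phi.
Hypothesis phi_alpha : forall (g : 'Z_k) (a : A),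
  phi (alpha g a) = join_act alpha g (phi a) :> (unit_interval R -> B).
Hypothesis phi_beta : forall (g : 'Z_k) (a : A),
  phi (beta g a) = join_beta g (phi a) :> (unit_interval R -> B).

Definition inv_char := {x : A -> C | is_char x /\ forall g a, x (beta g a) = x a}.

Lemma inv_char_eq (x y : inv_char) : (forall a, sval x a = sval y a) -> x = y.
Proof.
case: x y => [x xP] [y yP] /= xy; have e : x = y by exact: funext.
by subst y; congr exist; exact: Prop_irrelevance.
Qed.

Lemma phi_linear c a b t : phi (c *: a + b) t = c *: phi a t + phi b t.
Proof. by have [-> _ _] := phi_hom. Qed.

Lemma phi1 t : phi 1 t = 1.
Proof. by have [_ [-> _] _] := phi_hom. Qed.

Lemma phiM a b t : phi (a * b) t = phi a t * phi b t.
Proof. by have [_ [_ ->] _] := phi_hom. Qed.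

Lemma phiP a : in_twisted_join (phi a).
Proof. exact/asboolP/(valP (phi a)). Qed.

Lemma flow_subproof (t : unit_interval R) (x : inv_char) :
  is_char (fun a => total_coef (sval x) (phi a t)) /\
  forall g a,
    total_coef (sval x) (phi (beta g a) t) = total_coef (sval x) (phi a t).
Proof.
case: x => x [xP xb] /=; have [hl h1 hM] := total_coef_char (B := B) xP xb.
split; first split.
- by move=> c a b; rewrite phi_linear hl.
- by rewrite phi1.
- by move=> a b; rewrite phiM hM.
move=> g a; rewrite phi_beta /join_beta /total_coef cp_coef_extend.
by apply: eq_bigr => j _; exact: xb.
Qed.

Definition flow t x : inv_char := exist _ _ (flow_subproof t x).

Lemma flow_start_subproof :
  is_char (fun a => group_sum (phi a (ui0 R))) /\
  forall g a, group_sum (phi (beta g a) (ui0 R)) = group_sum (phi a (ui0 R)).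
Proof.
have grp a : cp_group (phi a (ui0 R)) by have [] := phiP a.
split; first split.
- by move=> c a b; rewrite phi_linear group_sum_linear.
- by rewrite phi1 group_sum1.
- by move=> a b; rewrite phiM group_sumM.
move=> g a; rewrite phi_beta /join_beta /group_sum /total_coef cp_coef_extend.
have [c ->] := grp a; apply: eq_bigr => j _; rewrite cp_coef_group.
have [lin [b1 _] _] := act_hom beta g.
have b0 : beta g 0 = 0.
  by have := lin (-1) 0 0; rewrite scaler0 addr0 scaleN1r addNr.
by rewrite -[c j *: 1]addr0 lin b1 b0.
Qed.

Definition flow_start : inv_char := exist _ _ flow_start_subproof.

Lemma flow0 x : flow (ui0 R) x = flow_start.
Proof.
apply: inv_char_eq => a; apply: total_coef_group; first by case: x => x [].
by have [] := phiP a.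
Qed.

Lemma char_act_subproof (g : 'Z_k) (x : inv_char) :
  is_char (fun a => sval x (alpha g a)) /\
  forall h a, sval x (alpha g (beta h a)) = sval x (alpha g a).
Proof.
case: x => x [[xl x1 xM] xb] /=; have [lin [a1 aM] _] := act_hom alpha g.
split; last by move=> h a; rewrite alpha_beta xb.
split; [by move=> c a b; rewrite lin xl|by rewrite a1|by move=> a b; rewrite aM xM].
Qed.

Definition char_act g x : inv_char := exist _ _ (char_act_subproof g x).

Lemma iter_char_act s x a : sval (iter s (char_act 1) x) a = sval x (alpha s%:R a).
Proof.
elim: s a => [|s IH] a; first by rewrite act0.
by rewrite iterS /= IH -actD natr1.
Qed.

Lemma iter_char_act_k x : iter k (char_act 1) x = x.
Proof. by apply: inv_char_eq => a; rewrite iter_char_act pchar_Zp // act0. Qed.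

(** The values at time [1] have a single coefficient, at the unit of the
    group, on which the dual action is trivial. *)
Lemma flow1_equivariant x :
  flow (ui1 R) (char_act 1 x) = char_act 1 (flow (ui1 R) x).
Proof.
apply: inv_char_eq => a /=.
rewrite phi_alpha /join_act /total_coef cp_coef_extend cp_coef_dual.
have [_ _ [b _ <-]] := phiP a.
apply: eq_bigr => j _; rewrite cp_coef_emb; case: eqP => [->|_].
  by rewrite mul0n expr0 scale1r.
by rewrite scaler0.
Qed.

Definition grid_time (m j : nat) : R := Num.min 1 (j%:R / m%:R).

Lemma grid_time01 m j : grid_time m j \in `[0, 1]%classic.
Proof.
rewrite inE /= in_itv /= /grid_time ge_min lexx /= le_min ler01.
by rewrite divr_ge0.
Qed.

Definition grid_point m j : unit_interval R :=
  exist (fun t => t \in `[0 : R, 1]%classic) _ (grid_time01 m j).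

Lemma grid_point0 m : grid_point m 0 = ui0 R.
Proof.
apply: val_inj => /=; rewrite /grid_time mul0r; apply/min_idPr.
exact: ler01.
Qed.

Lemma grid_point1 m : (0 < m)%N -> grid_point m m = ui1 R.
Proof.
move=> m0; apply: val_inj => /=; rewrite /grid_time divff ?minxx //.
by rewrite pnatr_eq0 -lt0n.
Qed.

Lemma grid_point_close m j i i' : (j < m)%N -> (j <= i <= j.+1)%N ->
  (j <= i' <= j.+1)%N ->
  `|set_val (grid_point m i) - set_val (grid_point m i')| <= m%:R^-1 :> R.
Proof.
move=> jm; have m0 : (0 < m)%N by exact: leq_ltn_trans jm.
have mR0 : 0 < m%:R :> R by rewrite ltr0n.
have timeE l : (j <= l <= j.+1)%N -> set_val (grid_point m l) = l%:R / m%:R :> R.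
  move=> /andP[_ lj]; rewrite /= /grid_time; apply/min_idPr.
  by rewrite ler_pdivrMr // mul1r ler_nat (leq_trans lj).
move=> ij i'j; rewrite !timeE // -mulrBl normrM normfV (gtr0_norm mR0).
rewrite ler_piMl ?invr_ge0 ?ler0n //.
move: ij i'j => /andP[i1 i2] /andP[i'1 i'2].
rewrite ler_norml; move: i1 i2 i'1 i'2; rewrite -!(ler_nat R) -natr1.
by move=> *; apply/andP; split; lra.
Qed.

(** A base of the weak uniformity of the space of characters, made invariant under
    the action by testing on whole orbits. *)
Definition char_nbhd (E : inv_char -> inv_char -> Prop) :=
  exists (S : seq A) (e : C),
  0 < e /\ E = fun x y => forall a g, a \in S ->
    `|sval x (alpha g a) - sval y (alpha g a)| < e.

(** Moving in time by one mesh changes the values by less than [e / 2] as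
    characters are contractive.  At a fixed time, the values of the flow are sums
    of values at the coefficients of [phi b], and only the finitely many
    coefficients at the times of the grid matter. *)
Lemma char_nbhd_cone E' : char_nbhd E' ->
  exists2 E, char_nbhd E & exists (H : nat -> inv_char -> inv_char) (m : nat),
    [/\ (0 < m)%N, forall x, H 0 x = flow_start,
        forall x, H m (char_act 1 x) = char_act 1 (H m x)
      & forall x z j i i', E x z -> (j < m)%N -> (j <= i <= j.+1)%N ->
          (j <= i' <= j.+1)%N -> E' (H i x) (H i' z)].
Proof.
move=> [S [e [e0 ->]]].
pose S1 := [seq alpha g a | a <- S, g <- enum 'Z_k].
have e20 : 0 < e / 2 by rewrite divr_gt0.
have : \forall m \near \oo, forall b, b \in S1 -> forall u v : unit_interval R,
    `|set_val u - set_val v| <= (m.+1%:R)^-1 -> `|phi b u - phi b v| < e / 2.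
  elim: S1 => [|b S1 IH]; first by apply: nearW.
  have [bc _ _] := phiP b; have := uniformly_continuous_ui bc e20.
  apply: filterS2 IH => m h1 h2 b'; rewrite inE => /predU1P[->|] //; exact: h1.
case=> N _ /(_ N (leqnn N)) /= unif; pose m := N.+1.
(* All coefficients met at times of the grid. *)
pose T := [seq cp_coef (phi b (grid_point m jl.1)) jl.2
  | b <- S1, jl <- [seq (j, l) | j <- iota 0 m.+1, l <- enum 'Z_k]].
pose e' := e / 2 / #|'Z_k|%:R.
have k0 : 0 < #|'Z_k|%:R :> C by rewrite ltr0n card_ord.
have e'0 : 0 < e' by rewrite divr_gt0.
exists (fun x y => forall a g, a \in T ->
  `|sval x (alpha g a) - sval y (alpha g a)| < e'); first by exists T, e'.
exists (fun j => flow (grid_point m j)), m; split=> //.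
- by move=> x; rewrite grid_point0 flow0.
- by move=> x; rewrite grid_point1 // flow1_equivariant.
move=> x z j i i' xz jm ij i'j a g aS.
have bS1 : alpha g a \in S1 by apply: allpairs_f => //; rewrite mem_enum.
move: (alpha g a) bS1 => b bS1 {a g aS} /=.
have im : (i < m.+1)%N by case/andP: ij => _ /leq_ltn_trans; apply.
apply: le_lt_trans (ler_distD (total_coef (sval z) (phi b (grid_point m i))) _ _) _.
rewrite [ltRHS]splitr; apply: ler_ltD.
  rewrite /total_coef -sumrB (le_trans (ler_norm_sum _ _ _)) //.
  apply: (@le_trans _ _ (\sum_(l : 'Z_k) e')); last first.
    by rewrite sumr_const -[leLHS]mulr_natr divfK // gt_eqF.
  apply: ler_sum => l _; apply: ltW.
  have := xz (cp_coef (phi b (grid_point m i)) l) 0; rewrite !act0; apply.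
  apply/allpairsP; exists (b, (i, l)); split=> //.
  by apply/allpairsP; exists (i, l); rewrite mem_iota mem_enum.
have [zP zb] := svalP z.
rewrite -(charB (total_coef_char zP zb)).
apply: le_lt_trans (char_norm (total_coef_char zP zb) _) _.
by apply: unif => //; exact: grid_point_close jm ij i'j.
Qed.

(** If two near characters had equal colors and distinct labels, then with the
    values at [a i] of their nearby orbit representatives one would have
    [omega ^ s z] and [omega ^ t z] near each other, although [z] is bounded
    below for some [i]. *)
Lemma flow_absurd : free_action alpha -> False.
Proof.
move=> free; pose chi := @omega_char R k.
have [n [a [d [d0 aP dP]]]] :=
  isotypic_lower_bound free (@omega_char_is_character R k k_gt1).
have charP (x : inv_char) : is_char (sval x) by have [] := svalP x.
have act_a (x : inv_char) g i : sval x (alpha g (a i)) = chi g * sval x (a i).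
  by rewrite aP charZ.
have [label [rep [label_g rep_g repE]]] : exists (label : inv_char -> 'Z_k) rep,
    [/\ forall x, label (char_act 1 x) = label x + 1,
        forall x, rep (char_act 1 x) = rep x
      & forall x, x = iter (label x) (char_act 1) (rep x)].
  apply: orbit_labels => // [|x s sk sx]; first exact: iter_char_act_k.
  apply/eqP/negPn; rewrite -lt0n; apply/negP => s0.
  have [i di] := dP _ (charP x).
  have := iter_char_act s x (a i); rewrite sx act_a /chi /omega_char val_Zp_nat //.
  rewrite modn_small // -[LHS]mul1r => /mulIf h.
  have /h/esym/eqP : sval x (a i) != 0 by rewrite -normr_gt0 (lt_le_trans d0).
  by apply/negP/omega_neq1 => //; rewrite s0.
have [c c0 cP] := @omega_char_separated R k k_gt1.
(* Two errors of size e occur: nearness of the points, and of the values that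
   share a color. *)
pose e := c * d / 2; have e0 : 0 < e by rewrite divr_gt0 // mulr_gt0.
have [T [col colP]] := finite_coloring (\sum_i `|a i|) e0.
pose color x : nat := enum_rank [ffun i => col (sval (rep x) (a i))].
pose E := fun x y : inv_char => forall b g, b \in [seq a i | i <- enum 'I_n] ->
    `|sval x (alpha g b) - sval y (alpha g b)| < e.
have UE : char_nbhd E by exists [seq a i | i <- enum 'I_n], e.
have value x i : sval x (a i) = chi (label x) * sval (rep x) (a i).
  by rewrite {1}(repE x) iter_char_act natr_Zp act_a.
have compat x y : E x y -> color x = color y -> label x = label y.
  move=> xy /val_inj/enum_rank_inj/ffunP colxy.
  apply/eqP/negPn/negP => /cP lxy; have [i di] := dP _ (charP (rep x)).
  have bound (z : inv_char) : `|sval z (a i)| <= \sum_i `|a i|.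
    apply: le_trans (char_norm (charP z) _) _.
    by rewrite (bigD1 i) //= lerDl sumr_ge0.
  have rxy : `|sval (rep y) (a i) - sval (rep x) (a i)| < e.
    rewrite distrC; apply: colP => //; by have := colxy i; rewrite !ffunE.
  have ai : a i \in [seq a i | i <- enum 'I_n] by apply: map_f; rewrite mem_enum.
  have := xy (a i) 0 ai; rewrite !act0 (value x) (value y) => vxy.
  have : c * d <= `|(chi (label x) - chi (label y)) * sval (rep x) (a i)|.
    by rewrite normrM ler_pM // ltW.
  have -> : (chi (label x) - chi (label y)) * sval (rep x) (a i) =
    (chi (label x) * sval (rep x) (a i) - chi (label y) * sval (rep y) (a i)) +
    chi (label y) * (sval (rep y) (a i) - sval (rep x) (a i)).
    by rewrite mulrBl mulrBr addrA subrK.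
  move=> /le_trans /(_ (ler_normD _ _)); rewrite [X in _ + X]normrM norm_omega mul1r.
  by move=> /le_lt_trans /(_ (ltrD vxy rxy)); rewrite -splitr ltxx.
have [h th] : exists h : chain #|{ffun 'I_n -> T}| inv_char,
    tower (char_act 1) k E h.
  apply: (tower_exists iter_char_act_k (U := char_nbhd) (y := flow_start)) => //.
  - by move=> _ [S [r [r0 ->]]] x b g _; rewrite subrr normr0.
  - move=> _ [S [r [r0 ->]]] x z xz b g bS /=.
    by rewrite -!actD; exact: xz.
  - exact: char_nbhd_cone.
apply: (no_tower k_gt1 (color := color) (label := label) _ _ label_g compat th).
  by move=> x; exact: ltn_ord.
by move=> x; rewrite /color rep_g.
Qed.

End Flow.

Theorem theorem2p3 (R : realType) (k : nat) (k_ge2 : (2 <= k)%N)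
    (A : cstarAlgType R) (alpha beta : star_action 'Z_k A)
    (alpha_beta : commuting alpha beta) (alpha_free : free_action alpha)
    (B : crossed_product beta) :
  ~ exists phi : A -> twisted_join B,
      [/\ unital_star_hom phi,
          forall (g : 'Z_k) (a : A),
            phi (alpha g a) = join_act alpha g (phi a) :> (unit_interval R -> B)
        & forall (g : 'Z_k) (a : A),
            phi (beta g a) = join_beta g (phi a) :> (unit_interval R -> B)].
Proof.
move=> [phi [phi_hom phi_alpha phi_beta]].
exact: (flow_absurd k_ge2 alpha_beta phi_hom phi_alpha phi_beta).
Qed.
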